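(* Let $k>0$ and $\beta>0$ satisfy $$\left(1+\frac{4}{\pi^2}\right)\beta<k,\qquad \eta(\beta,k)<\min\{1,k\},$$ where $\eta(\beta,k)=\max\left\{\beta,\ \frac{4\beta}{\pi^2k-(\pi^2+4)\beta}\right\}$, and let the well-posedness assumption (WP) stated in the context be valid. Then for any $\varepsilon>0$ such that $\eta(\beta,k)<\varepsilon<\min\{1,k\}$, and for all $\alpha>0$ satisfying the inequality $$\frac{\varepsilon k}{2}\alpha^2-k\alpha+\frac{\varepsilon}{2}\le 0,$$ there exist $\delta>0$ and $M>0$ such that for all $\gamma>0$ and for any initial conditions $(z^0,z^1)\in\mathcal{W}_0$ and $(\widehat z^0,\widehat z^1)\in\mathcal{W}_0$, the corresponding solution $(z,\widehat z)$ of the closed-loop system (CL) of the context satisfies $$E(t)\le M\,E(0)\,e^{-\delta t}\qquad\forall t\in[0,T_{\max}),$$ where $E(t)=\frac12\int_0^1\big(e_t(t,x)^2+k\,e_x(t,x)^2\big)\,dx$ and $e=z-\widehat z$.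
   Context: Fix parameters $k>0$, $\beta>0$, a desired energy level $H^*\ge 0$, and a continuous function $\psi\colon\mathbb{R}\to\mathbb{R}$ with $\psi(0)=0$ and $\psi(s)s>0$ for all $s\ne0$. The energy (Hamiltonian) of a function $z(t,x)$ at time $t$ is $$H(z(t))=\int_0^1\left(\frac{z_t(t,x)^2}{2}+k\frac{z_x(t,x)^2}{2}+\beta(1-\cos z(t,x))\right)dx .$$ For an observer gain $\alpha>0$ and a control gain $\gamma>0$, the closed-loop system (CL) for the pair $(z,\widehat z)$ is \begin{gather*} z_{tt}(t,x)-kz_{xx}(t,x)+\beta\sin z(t,x)=0,\quad t\ge0,\ x\in(0,1),\\ \widehat z_{tt}(t,x)-k\widehat z_{xx}(t,x)+\beta\sin\widehat z(t,x)=0,\quad t\ge0,\ x\in(0,1),\\ z(0,x)=z^0(x),\quad z_t(0,x)=z^1(x),\quad \widehat z(0,x)=\widehat z^0(x),\quad \widehat z_t(0,x)=\widehat z^1(x),\quad x\in(0,1),\\ z(t,0)=0,\quad z_x(t,1)=u(t),\quad t\ge0,\\ \widehat z(t,0)=0,\quad \widehat z_x(t,1)=u(t)+\alpha\big(z_t(t,1)-\widehat z_t(t,1)\big),\quad t\ge0,\\ u(t)=-\gamma\,\psi\big(H(\widehat z(t))-H^*\big)\,z_t(t,1),\quad t\ge0 . \end{gather*} Well-posedness assumption (WP): for all $\alpha>0$ and $\gamma>0$ there is a nonempty set of initial data $\mathcal{W}_0\subseteq W^2_2(0,1)\times W^1_2(0,1)$ ($W^m_p(0,1)$ being Sobolev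 spaces; $\mathcal{W}_0$ may depend on the parameters of the system) such that for any $(z^0,z^1)\in\mathcal{W}_0$ and $(\widehat z^0,\widehat z^1)\in\mathcal{W}_0$ there exists a unique regular solution $(z,\widehat z)$ of (CL) such that (1) it is defined on a maximal interval of existence $[0,T_{\max})$, $0<T_{\max}\le+\infty$, and if $T_{\max}<+\infty$, then $H(z(t))+H(\widehat z(t))\to+\infty$ as $t\to T_{\max}$; (2) the functions $t\mapsto H(z(t))$ and $t\mapsto H(\widehat z(t))$ are locally absolutely continuous. Here ''regular'' means that $$z,\widehat z\in C\big([0,T_{\max});W^2_2(0,1)\big)\cap C^1\big([0,T_{\max});W^1_2(0,1)\big)\cap C^2\big([0,T_{\max});L_2(0,1)\big).$$ *)

(* Defs.v *)
From HB Require Import structures.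
From mathcomp Require Import all_boot all_order all_algebra.
From mathcomp Require Import all_classical all_reals all_analysis.

Set Implicit Arguments.
Unset Strict Implicit.
Unset Printing Implicit Defensive.

Import Order.TTheory GRing.Theory Num.Theory.
Import numFieldNormedType.Exports.

Local Open Scope classical_set_scope.
Local Open Scope ring_scope.

(** * Lebesgue and Sobolev spaces on the unit interval

  The elements of these spaces are represented by functions [R -> R], of which
  only the values on [0, 1] matter. *)

Definition int01 (R : realType) (f : R -> R) : R :=
  \int[@lebesgue_measure R]_(x in `[0, 1]) f x.

Definition in_L2 (R : realType) (f : R -> R) : Prop :=
  f \_ `[0, 1] \in Lfun (@lebesgue_measure R) 2%:E.

Definition L2norm (R : realType) (f : R -> R) : R :=
  fine 'N[@lebesgue_measure R]_2%:E[EFin \o (f \_ `[0, 1])].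

(** Test functions: class C^1 with compact support in the open interval. *)
Definition test_function (R : realType) (phi : R -> R) : Prop :=
  [/\ forall x, derivable phi x 1,
      continuous (derive1 phi) &
      exists a b : R, [/\ 0 < a, b < 1 &
        forall x, phi x != 0 -> a <= x <= b]].

Definition weak_derivative (R : realType) (f g : R -> R) : Prop :=
  forall phi, test_function phi ->
    int01 (fun x => f x * derive1 phi x) = - int01 (fun x => g x * phi x).

(** [f] belongs to W^1_2(0,1) and its weak derivative is [g].  Every class in
  W^1_2(0,1) has exactly one representative continuous on [0, 1], and [f] is
  required to be that one, so that its values at the points of [0, 1] (in
  particular its traces at 0 and 1) are meaningful; [g] is determined almost
  everywhere only. *)
Definition W12_deriv (R : realType) (f g : R -> R) : Prop :=
  [/\ in_L2 f, in_L2 g, weak_derivative f g &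
      {within `[0, 1], continuous f}].

Definition W12 (R : realType) : set (R -> R) :=
  [set f | exists g, W12_deriv f g].

Definition W22 (R : realType) : set (R -> R) :=
  [set f | exists2 g, W12_deriv f g & W12 g].

(** * Curves in L_2(0,1) on the time interval [0, T[ *)

Definition time_dom (R : realType) (T : \bar R) : set R :=
  [set t | 0 <= t /\ (t%:E < T)%E].

Definition L2_continuous (R : realType) (T : \bar R) (F : R -> R -> R) : Prop :=
  forall t, time_dom T t ->
    L2norm (fun x => F s x - F t x) @[s --> within (time_dom T) (nbhs t)]
      --> (0 : R).

(** [F'] is the derivative of [F] in the norm of L_2(0,1), one-sided at 0. *)
Definition L2_derivative (R : realType) (T : \bar R) (F F' : R -> R -> R) :
    Prop :=
  forall t, time_dom T t ->
    L2norm (fun x => (s - t)^-1 * (F s x - F t x) - F' t x)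
      @[s --> within (time_dom T) t^'] --> (0 : R).

(** * Trajectories

  A function of [(t, x)], time first, together with its partial
  derivatives. *)
Record trajectory (R : realType) := Trajectory {
  traj :> R -> R -> R ;
  dx  : R -> R -> R ;
  dxx : R -> R -> R ;
  dt  : R -> R -> R ;
  dtx : R -> R -> R ;
  dtt : R -> R -> R }.

Definition traj_sub (R : realType) (z y : trajectory R) : trajectory R :=
  {| traj := fun t x => z t x - y t x ;
     dx  := fun t x => dx z t x - dx y t x ;
     dxx := fun t x => dxx z t x - dxx y t x ;
     dt  := fun t x => dt z t x - dt y t x ;
     dtx := fun t x => dtx z t x - dtx y t x ;
     dtt := fun t x => dtt z t x - dtt y t x |}.

(** [z] belongs to C([0,T[; W^2_2) /\ C^1([0,T[; W^1_2) /\ C^2([0,T[; L_2), and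
  the fields of [z] are its derivatives.  The squared norm of W^m_2 is the sum
  of the squared L_2 norms of the weak derivatives of order at most m, so
  continuity and differentiability of curves in W^m_2 are expressed
  derivative by derivative. *)
Definition regular (R : realType) (T : \bar R) (z : trajectory R) : Prop :=
  [/\ forall t, time_dom T t ->
        [/\ W12_deriv (z t) (dx z t), W12_deriv (dx z t) (dxx z t),
            W12_deriv (dt z t) (dtx z t) & in_L2 (dtt z t)],
      [/\ L2_continuous T z, L2_continuous T (dx z) &
          L2_continuous T (dxx z)],
      [/\ L2_derivative T z (dt z), L2_derivative T (dx z) (dtx z),
          L2_continuous T (dt z) & L2_continuous T (dtx z)] &
      L2_derivative T (dt z) (dtt z) /\ L2_continuous T (dtt z)].

(** * The closed-loop system *)

Definition hamiltonian (R : realType) (k beta : R) (z : trajectory R) (t : R) :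
    R :=
  int01 (fun x => dt z t x ^+ 2 / 2 + k * (dx z t x ^+ 2 / 2)
                  + beta * (1 - cos (z t x))).

Definition error_energy (R : realType) (k : R) (e : trajectory R) (t : R) : R :=
  2^-1 * int01 (fun x => dt e t x ^+ 2 + k * dx e t x ^+ 2).

(** The terms [dtt] and [dxx] are elements of L_2(0,1), hence the equation
  holds for almost every x at each time. *)
Definition sine_gordon (R : realType) (k beta : R) (T : \bar R)
    (z : trajectory R) : Prop :=
  forall t, time_dom T t ->
    {ae @lebesgue_measure R, forall x, 0 < x < 1 ->
      dtt z t x - k * dxx z t x + beta * sin (z t x) = 0}.

Definition initial_data (R : realType) (z : trajectory R)
    (d : (R -> R) * (R -> R)) : Prop :=
  forall x, 0 < x < 1 -> z 0 x = d.1 x /\ dt z 0 x = d.2 x.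

(** The data k, beta, H^* and psi, in this order. *)
Record system (R : realType) := System {
  stiffness : R ;
  potential : R ;
  target : R ;
  feedback : R -> R }.

Definition control (R : realType) (p : system R) (gamma : R)
    (z zh : trajectory R) (t : R) : R :=
  - gamma
  * feedback p (hamiltonian (stiffness p) (potential p) zh t - target p)
  * dt z t 1.

(** [(z, zh)] is a regular solution of the closed-loop system on [0, T[ with
  initial data [d] and [dh]. *)
Definition regular_solution (R : realType) (p : system R) (alpha gamma : R)
    (d dh : (R -> R) * (R -> R)) (T : \bar R) (z zh : trajectory R) : Prop :=
  let k := stiffness p in let beta := potential p in
  [/\ (0 < T)%E,
      regular T z /\ regular T zh,
      sine_gordon k beta T z /\ sine_gordon k beta T zh,
      initial_data z d /\ initial_data zh dh &
      forall t, time_dom T t ->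
        [/\ z t 0 = 0, dx z t 1 = control p gamma z zh t,
            zh t 0 = 0 &
            dx zh t 1 = control p gamma z zh t
                        + alpha * (dt z t 1 - dt zh t 1)]].

Definition agree (R : realType) (T : \bar R) (z y : trajectory R) : Prop :=
  forall t x, time_dom T t -> 0 <= x <= 1 -> z t x = y t x.

(** No regular solution with the same data extends [(z, zh)] beyond [T]. *)
Definition maximal_solution (R : realType) (p : system R) (alpha gamma : R)
    (d dh : (R -> R) * (R -> R)) (T : \bar R) (z zh : trajectory R) : Prop :=
  regular_solution p alpha gamma d dh T z zh /\
  forall T' z' zh', regular_solution p alpha gamma d dh T' z' zh' ->
    agree T z z' -> agree T zh zh' -> (T' <= T)%E.

Definition absolutely_continuous (R : realType) (a b : R) (f : R -> R) : Prop :=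
  forall eps : R, 0 < eps -> exists2 delta : R, 0 < delta &
    forall (n : nat) (u v : 'I_n -> R),
      (forall i, [/\ a <= u i, u i <= v i & v i <= b]) ->
      (forall i j, i != j -> v i <= u j \/ v j <= u i) ->
      \sum_(i < n) (v i - u i) < delta ->
      \sum_(i < n) `|f (v i) - f (u i)| < eps.

Definition locally_absolutely_continuous (R : realType) (T : \bar R)
    (f : R -> R) : Prop :=
  forall b, time_dom T b -> absolutely_continuous 0 b f.

Definition WP_solution (R : realType) (p : system R) (alpha gamma : R)
    (d dh : (R -> R) * (R -> R)) (T : \bar R) (z zh : trajectory R) : Prop :=
  let H := hamiltonian (stiffness p) (potential p) in
  [/\ maximal_solution p alpha gamma d dh T z zh,
      forall b : R, T = b%:E -> H z t + H zh t @[t --> b^'-] --> +oo,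
      locally_absolutely_continuous T (H z) &
      locally_absolutely_continuous T (H zh)].

(** The parameters of the system other than the gains being fixed, the set of
  initial data [W0] depends on the gains [alpha] and [gamma] only. *)
Definition well_posed (R : realType) (p : system R)
    (W0 : R -> R -> set ((R -> R) * (R -> R))) : Prop :=
  forall alpha gamma : R, 0 < alpha -> 0 < gamma ->
    [/\ W0 alpha gamma !=set0,
        W0 alpha gamma `<=` @W22 R `*` @W12 R &
        forall d dh, W0 alpha gamma d -> W0 alpha gamma dh ->
          exists T z zh, WP_solution p alpha gamma d dh T z zh /\
            forall T' z' zh', WP_solution p alpha gamma d dh T' z' zh' ->
              [/\ T' = T, agree T z' z & agree T zh' zh]].

Definition eta_gain (R : realType) (beta k : R) : R :=
  Num.max beta (4 * beta / (pi ^+ 2 * k - (pi ^+ 2 + 4) * beta)).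

(* Main.v *)
Require Import Defs.
From HB Require Import structures.
From mathcomp Require Import all_boot all_order all_algebra.
From mathcomp Require Import all_classical all_reals all_analysis.
From mathcomp Require Import measurable_realfun ring lra.

Set Implicit Arguments.
Unset Strict Implicit.
Unset Printing Implicit Defensive.

Import Order.TTheory GRing.Theory Num.Theory.
Import numFieldNormedType.Exports.

Local Open Scope classical_set_scope.
Local Open Scope ring_scope.

(** The error [e = z - zh] solves [e_tt - k e_xx + beta g = 0], where
  [g = sin z - sin zh], with [e(t, 0) = 0] and
  [e_x(t, 1) = - alpha e_t(t, 1)]: the control cancels in the difference, which
  is why the decay rate can be chosen independently of [gamma].

  The proof is Lyapunov's method with the multiplier [x e_x]:
  [V = E + eps \int x e_x e_t].  Integrating by parts in [x],
  [V' = (eps k alpha^2 / 2 - k alpha + eps / 2) e_t(t, 1)^2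
        - eps / 2 \int (e_t^2 + k e_x^2) - beta \int (e_t + eps x e_x) g].
  The boundary term is nonpositive by the assumption on [alpha].  Since
  [|g| <= |e|], Young's inequality and the sharp Poincare inequality
  [\int e^2 <= 4 / pi^2 \int e_x^2] ([poincare]) absorb the last integral, and
  the assumption [eta_gain beta k < eps] says exactly that the coefficients of
  [\int e_t^2] and [\int e_x^2] so obtained are negative
  ([lyapunov_dissipation]).  As [eps < min 1 k], [V] lies between two positive
  multiples of [E]; hence [V' <= - delta V], and Gronwall's lemma ([gronwall])
  concludes.

  These computations have to be justified for functions with square integrable
  weak derivatives.  In space, testing a weak derivative against smoothed
  indicators of intervals shows that a continuous representative is the
  integral of its weak derivative ([W12_primitive]), and integrals satisfy the
  product rule ([primitive01M]), hence integration by parts.  In time,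
  differentiability in the norm of L_2 suffices to differentiate inner products
  ([inner_derivative]).  The boundary value [e_t(t, 0) = 0] is the limit of the
  boundary values of the difference quotients of [e]
  ([trace0_derivative]). *)

(** * Square integrable functions on the unit interval *)

Section square_integrable.
Context {R : realType}.
Local Notation mu := (@lebesgue_measure R).
Implicit Types (f g h : R -> R) (c x : R).

Definition L1 f : Prop := mu.-integrable `[0, 1] (EFin \o f).

(** [in_L2] in terms of integrals over [0, 1] (see [in_L2_sqint]), a form from
  which bilinearity and integrability of products are immediate. *)
Definition sqint f : Prop :=
  measurable_fun (`[0, 1] : set R) f /\ L1 (fun x => f x ^+ 2).

Definition inner f g : R := int01 (fun x => f x * g x).

Lemma L1D f g : L1 f -> L1 g -> L1 (fun x => f x + g x).
Proof.
move=> f1 g1; rewrite /L1 (_ : _ \o _ = (EFin \o f) \+ (EFin \o g))%E//.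
exact: integrableD.
Qed.

Lemma L1B f g : L1 f -> L1 g -> L1 (fun x => f x - g x).
Proof.
move=> f1 g1; rewrite /L1 (_ : _ \o _ = (EFin \o f) \- (EFin \o g))%E//.
exact: integrableB.
Qed.

Lemma L1Z c f : L1 f -> L1 (fun x => c * f x).
Proof.
move=> f1; rewrite /L1 (_ : _ \o _ = (fun x => c%:E * (EFin \o f) x))%E//.
exact: integrableZl.
Qed.

Lemma L1_le f g : measurable_fun (`[0, 1] : set R) f ->
  (forall x, 0 <= x <= 1 -> `|f x| <= g x) -> L1 g -> L1 f.
Proof.
move=> mf fg; apply: le_integrable => //; first exact/measurable_EFinP.
move=> x /=; rewrite in_itv/= lee_fin => x01.
exact: le_trans (fg x x01) (ler_norm _).
Qed.

Lemma L1_measurable f : L1 f -> measurable_fun (`[0, 1] : set R) f.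
Proof. by move=> /(measurable_int mu) /measurable_EFinP. Qed.

Lemma L1_continuous f : {within `[0, 1], continuous f} -> L1 f.
Proof.
move=> cf; apply: continuous_compact_integrable => //.
exact: segment_compact.
Qed.

Lemma L1_cst c : L1 (fun=> c).
Proof. by apply: L1_continuous => x; exact: cvg_cst. Qed.

Lemma L1_abs f : L1 f -> L1 (fun x => `|f x|).
Proof. by move=> /integrable_norm; apply. Qed.

Lemma int01D f g : L1 f -> L1 g ->
  int01 (fun x => f x + g x) = int01 f + int01 g.
Proof. by move=> *; rewrite /int01 RintegralD. Qed.

Lemma int01B f g : L1 f -> L1 g ->
  int01 (fun x => f x - g x) = int01 f - int01 g.
Proof. by move=> *; rewrite /int01 RintegralB. Qed.

Lemma int01Z c f : L1 f -> int01 (fun x => c * f x) = c * int01 f.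
Proof. by move=> *; rewrite /int01 RintegralZl. Qed.

Lemma int01_cst c : int01 (fun=> c) = c.
Proof.
rewrite /int01 Rintegral_cst// [X in fine X](lebesgue_measure_itv `[0, 1])/=.
by rewrite lte01 sube0 mulr1.
Qed.

Lemma int01_ge0 f : (forall x, 0 <= x <= 1 -> 0 <= f x) -> 0 <= int01 f.
Proof.
by move=> f0; apply: Rintegral_ge0 => x /=; rewrite in_itv/=; exact: f0.
Qed.

Lemma le_int01 f g : L1 f -> L1 g -> (forall x, 0 <= x <= 1 -> f x <= g x) ->
  int01 f <= int01 g.
Proof.
move=> f1 g1 fg; apply: le_Rintegral => // x /=; rewrite in_itv/=; exact: fg.
Qed.

Lemma ae_eq_int01 f g : L1 f -> L1 g ->
  {ae mu, forall x, 0 < x < 1 -> f x = g x} -> int01 f = int01 g.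
Proof.
move=> f1 g1 fg; rewrite /int01.
have O h : L1 h -> \int[mu]_(x in `[0, 1]) h x = \int[mu]_(x in `]0, 1[) h x.
  move=> h1; rewrite Rintegral_itv_bndo_bndc; last first.
    apply: integrableS h1 => // x /=; rewrite !in_itv/=.
    by move=> /andP[/ltW -> /ltW ->].
  rewrite Rintegral_itv_obnd_cbnd//.
  by apply: integrableS h1 => // x /=; rewrite !in_itv/= => /andP[/ltW -> ->].
have mO h : L1 h -> measurable_fun (`]0, 1[ : set R) (EFin \o h).
  move=> /L1_measurable mh; apply/measurable_EFinP.
  apply: measurable_funS mh => // x /=; rewrite !in_itv/=.
  by move=> /andP[/ltW -> /ltW ->].
rewrite !O// /Rintegral; congr fine.
apply: ae_eq_integral => //; [exact: mO..|].
have [N [mN N0 sN]] := fg; exists N; split => // x /= nx; apply: sN => /= fgx.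
by apply: nx; rewrite in_itv/= => /fgx ->.
Qed.

Lemma sqint_L1M f g : sqint f -> sqint g -> L1 (fun x => f x * g x).
Proof.
move=> [mf f2] [mg g2]; apply: (@L1_le _ (fun x => f x ^+ 2 + g x ^+ 2)).
- exact: measurable_funM.
- by move=> x _; rewrite ler_norml; apply/andP; split; nra.
- exact: L1D.
Qed.

Lemma sqintD f g : sqint f -> sqint g -> sqint (fun x => f x + g x).
Proof.
move=> sf sg; split.
  by apply: measurable_funD; [case: sf|case: sg].
have -> : (fun x => (f x + g x) ^+ 2) =
  (fun x => f x ^+ 2 + (2 * (f x * g x) + g x ^+ 2)).
  by apply/funext => x; ring.
by apply: L1D; [case: sf|apply: L1D; [apply: L1Z; exact: sqint_L1M|case: sg]].
Qed.

Lemma sqintZ c f : sqint f -> sqint (fun x => c * f x).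
Proof.
move=> [mf f2]; split; first exact: measurable_funM.
have -> : (fun x => (c * f x) ^+ 2) = (fun x => c ^+ 2 * f x ^+ 2).
  by apply/funext => x; ring.
exact: L1Z.
Qed.

Lemma sqintB f g : sqint f -> sqint g -> sqint (fun x => f x - g x).
Proof.
move=> sf /(sqintZ (-1)) sg; have := sqintD sf sg.
by congr sqint; apply/funext => x; ring.
Qed.

Lemma sqint_le f g : measurable_fun (`[0, 1] : set R) f ->
  (forall x, 0 <= x <= 1 -> `|f x| <= `|g x|) -> sqint g -> sqint f.
Proof.
move=> mf fg [mg g2]; split => //; apply: L1_le g2.
  exact: measurable_funX.
move=> x /fg fgx; rewrite normrX -(real_normK (num_real (g x))).
by rewrite lerXn2r// nnegrE.
Qed.

Lemma sqint_mulx f : sqint f -> sqint (fun x => x * f x).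
Proof.
move=> sf; apply: (sqint_le (g := f)) => //.
  by apply: measurable_funM => //; case: sf.
move=> x /andP[x0 x1]; rewrite normrM ger0_norm//.
by rewrite ler_piMl.
Qed.

Lemma within_continuousM (A : set R) f g : {within A, continuous f} ->
  {within A, continuous g} -> {within A, continuous (f \* g)}.
Proof. by move=> cf cg x; apply: continuousM; [exact: cf|exact: cg]. Qed.

Lemma sqint_continuous f : {within `[0, 1], continuous f} -> sqint f.
Proof.
move=> cf; split; first exact: L1_measurable (L1_continuous cf).
apply: L1_continuous; rewrite (_ : (fun _ => _) = f \* f).
  exact: within_continuousM.
by apply/funext => y; rewrite expr2.
Qed.

Lemma sqint1 : sqint (fun=> 1).
Proof. by apply: sqint_continuous => x; exact: cvg_cst. Qed.

Lemma sqint_L1 f : sqint f -> L1 f.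
Proof.
move=> /(sqint_L1M sqint1); congr L1; by apply/funext => x; rewrite mul1r.
Qed.

Lemma in_L2_sqint f : in_L2 f -> sqint f.
Proof.
move=> l2; have mf : measurable_fun (`[0, 1] : set R) f.
  have /andP[+ _] := l2; rewrite inE => mf.
  exact/measurable_restrictT.
split => //; have := Lfun2_integrable_sqr l2.
rewrite (_ : EFin \o _ = (EFin \o (fun x => f x ^+ 2)) \_ `[0, 1]).
  by move=> h; rewrite /L1; apply/integrable_mkcond.
rewrite restrict_EFin; apply/funext => x /=; congr EFin.
rewrite /patch; by case: ifP => //; rewrite expr0n.
Qed.

Lemma innerC f g : inner f g = inner g f.
Proof. by congr int01; apply/funext => x; rewrite mulrC. Qed.

Lemma innerDl f g h : sqint f -> sqint g -> sqint h ->
  inner (fun x => f x + g x) h = inner f h + inner g h.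
Proof.
move=> sf sg sh; rewrite /inner -int01D; [|exact: sqint_L1M..].
by congr int01; apply/funext => x; rewrite mulrDl.
Qed.

Lemma innerZl c f g : sqint f -> sqint g ->
  inner (fun x => c * f x) g = c * inner f g.
Proof.
move=> sf sg; rewrite /inner -int01Z; last exact: sqint_L1M.
by congr int01; apply/funext => x; rewrite mulrA.
Qed.

Lemma innerBl f g h : sqint f -> sqint g -> sqint h ->
  inner (fun x => f x - g x) h = inner f h - inner g h.
Proof.
move=> sf sg sh; rewrite /inner -int01B; [|exact: sqint_L1M..].
by congr int01; apply/funext => x; rewrite mulrBl.
Qed.

Lemma innerDr f g h : sqint f -> sqint g -> sqint h ->
  inner h (fun x => f x + g x) = inner h f + inner h g.
Proof. by move=> *; rewrite innerC innerDl// !(innerC h). Qed.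

Lemma innerZr c f g : sqint f -> sqint g ->
  inner f (fun x => c * g x) = c * inner f g.
Proof. by move=> *; rewrite innerC innerZl// (innerC f). Qed.

Lemma innerBr f g h : sqint f -> sqint g -> sqint h ->
  inner h (fun x => f x - g x) = inner h f - inner h g.
Proof. by move=> *; rewrite innerC innerBl// !(innerC h). Qed.

Lemma inner_ge0 f : 0 <= inner f f.
Proof. by apply: int01_ge0 => x _; rewrite -expr2 sqr_ge0. Qed.

Lemma L2normX2 f : sqint f -> L2norm f ^+ 2 = inner f f.
Proof.
move=> [mf f2]; rewrite /inner; under eq_fun do rewrite -expr2.
rewrite /L2norm /int01 /Rintegral.
have E : ((\int[mu]_x `|(EFin \o (f \_ `[0, 1])%R) x| `^ 2) =
   \int[mu]_(x in `[0%R, 1%R]) ((f x ^+ 2)%R)%:E)%E.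
  rewrite [RHS]integral_mkcond; apply: eq_integral => x _ /=.
  rewrite /patch; case: ifP => _.
    by rewrite powR_mulrn// real_normK// num_real.
  by rewrite normr0 powR0// pnatr_eq0.
have : (\int[mu]_(x in `[0%R, 1%R]) ((f x ^+ 2)%R)%:E \is a fin_num)%E.
  exact: integrable_fin_num.
rewrite -E -poweR_Lnorm ?pnatr_eq0//.
have := Lnorm_ge0 mu 2%:E (EFin \o (f \_ `[0, 1])).
case: (Lnorm mu 2%:E _) => [r| |]//=; last by rewrite pnatr_eq0.
  by rewrite lee_fin => r0 _; rewrite powR_mulrn.
Qed.

Lemma inner_CauchySchwarz f g : sqint f -> sqint g ->
  inner f g ^+ 2 <= inner f f * inner g g.
Proof.
move=> sf sg; set A := inner f f; set B := inner f g; set C := inner g g.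
have Q s : 0 <= A * s ^+ 2 + 2 * s * B + C.
  have sF := sqintZ s sf; have := inner_ge0 (fun x => s * f x + g x).
  rewrite innerDl ?(innerDr sF sg)//; last exact: sqintD.
  by rewrite !innerZl// !innerZr// (innerC g f) -/A -/B -/C; lra.
have A0 : 0 <= A := inner_ge0 f.
have [A00|An0] := eqVneq A 0; last first.
  have Ap : 0 < A by rewrite lt0r An0.
  (* the minimum of the quadratic polynomial in [s] *)
  have := Q (- B / A).
  have -> : A * (- B / A) ^+ 2 + 2 * (- B / A) * B + C =
    (A * C - B ^+ 2) / A by field.
  by rewrite pmulr_lge0 ?invr_gt0// subr_ge0.
have [->|B0] := eqVneq B 0; first by rewrite A00 expr0n mul0r.
(* an affine function bounded below is constant *)
have := Q (- (C + 1) / (2 * B)); rewrite A00.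
have -> : 0 * (- (C + 1) / (2 * B)) ^+ 2 + 2 * (- (C + 1) / (2 * B)) * B + C
  = - 1 by field.
lra.
Qed.

Lemma inner_young f g : sqint f -> sqint g ->
  `|2 * inner f g| <= inner f f + inner g g.
Proof.
move=> sf sg; rewrite ler_norml; apply/andP; split.
  have := inner_ge0 (fun x => f x + g x).
  rewrite innerDl ?(innerDr sf sg)//; last exact: sqintD.
  by rewrite (innerC g f); lra.
have := inner_ge0 (fun x => f x - g x).
rewrite innerBl ?(innerBr sf sg)//; last exact: sqintB.
by rewrite (innerC g f); lra.
Qed.

Lemma le_inner f g : sqint f -> sqint g ->
  (forall x, 0 <= x <= 1 -> `|f x| <= `|g x|) -> inner f f <= inner g g.
Proof.
move=> sf sg fg; apply: le_int01; [exact: sqint_L1M..|move=> x /fg].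
rewrite -!expr2 -(real_normK (num_real (f x))) -(real_normK (num_real (g x))).
by move=> fgx; rewrite lerXn2r// nnegrE.
Qed.

Lemma inner_mulx_le f : sqint f ->
  inner (fun x => x * f x) (fun x => x * f x) <= inner f f.
Proof.
move=> sf; apply: le_inner => //; first exact: sqint_mulx.
by move=> x /andP[x0 x1]; rewrite normrM ger0_norm// ler_piMl.
Qed.

End square_integrable.

(** * Primitives on the unit interval *)

Section primitives.
Context {R : realType}.
Local Notation mu := (@lebesgue_measure R).
Implicit Types (f g h F G : R -> R) (a b c d e x y : R).

(** For a continuous [F] this is absolute continuity with derivative [G] almost
  everywhere; it is the form in which weak derivatives are used below. *)
Definition primitive01 F G : Prop := L1 G /\
  forall a b, 0 <= a -> a <= b -> b <= 1 ->
    F b - F a = \int[mu]_(x in `[a, b]) G x.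

Lemma L1_sub f a b : 0 <= a -> b <= 1 -> L1 f ->
  mu.-integrable `[a, b] (EFin \o f).
Proof.
move=> a0 b1; apply: integrableS => // x /=; rewrite !in_itv/= => /andP[ax xb].
by rewrite (le_trans a0 ax) (le_trans xb b1).
Qed.

Lemma primitive01_integral G : L1 G ->
  primitive01 (fun x => \int[mu]_(t in `[0, x]) G t) G.
Proof.
move=> G1; split => // a b a0 ab b1.
have G0b := L1_sub (lexx 0) b1 G1.
rewrite Rintegral_itvB ?bnd_simp//.
apply: Rintegral_itv_obnd_cbnd.
apply: integrableS (L1_sub a0 b1 G1) => // x /=; rewrite !in_itv/=.
by move=> /andP[/ltW -> ->].
Qed.

Lemma primitive01_continuous F G : primitive01 F G ->
  {within `[0, 1], continuous F}.
Proof.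
move=> [G1 FG].
have := parameterized_integral_continuous (@ler01 R) G1 => cI.
apply: (@subspace_eq_continuous _ _ _
  (fun x => F 0 + \int[mu]_(t in `[0, x]) G t)).
  move=> x; rewrite inE/= in_itv/= => /andP[x0 x1].
  by rewrite -FG// addrC subrK.
by move=> x; apply: cvgD; [exact: cvg_cst|exact: cI].
Qed.

Lemma primitive01_sqint F G : primitive01 F G -> sqint F.
Proof. by move=> /primitive01_continuous; exact: sqint_continuous. Qed.

Lemma primitive01_int01 F G : primitive01 F G -> int01 G = F 1 - F 0.
Proof. by move=> [_ ->]. Qed.

Lemma primitive01B F f G g : primitive01 F f -> primitive01 G g ->
  primitive01 (fun x => F x - G x) (fun x => f x - g x).
Proof.
move=> [f1 Ff] [g1 Gg]; split=> [|a b a0 ab b1]; first exact: L1B.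
by rewrite RintegralB//; [rewrite -Ff// -Gg//; ring|exact: L1_sub..].
Qed.

Lemma primitive01Z c F f : primitive01 F f ->
  primitive01 (fun x => c * F x) (fun x => c * f x).
Proof.
move=> [f1 Ff]; split=> [|a b a0 ab b1]; first exact: L1Z.
by rewrite RintegralZl//; [rewrite -Ff// mulrBr|exact: L1_sub].
Qed.

Lemma primitive01_C1 F f : (forall x, 0 <= x <= 1 -> is_derive x 1 F (f x)) ->
  {within `[0, 1], continuous f} -> primitive01 F f.
Proof.
move=> dF cf; split; first exact: L1_continuous.
move=> a b a0; rewrite le_eqVlt => /predU1P[<- _|ab b1].
  by rewrite set_itv1 Rintegral_set1 subrr.
have cF x : 0 <= x <= 1 -> {for x, continuous F}.
  by move=> /dF H; apply/differentiable_continuous/derivable1_diffP; case: H.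
rewrite /Rintegral (@continuous_FTC2 R f F a b)//.
- apply: continuous_subspaceW cf => x /=; rewrite !in_itv/= => /andP[ax xb].
  by rewrite (le_trans a0 ax) (le_trans xb b1).
- split.
  + move=> x; rewrite in_itv/= => /andP[ax xb].
    by have [] // : is_derive x 1 F (f x) by apply: dF; lra.
  + by apply: cvg_at_right_filter; apply: cF; lra.
  + by apply: cvg_at_left_filter; apply: cF; lra.
- move=> x; rewrite in_itv/= => /andP[ax xb]; rewrite derive1E.
  have H : is_derive x 1 F (f x) by apply: dF; lra.
  exact: derive_val.
Qed.

Lemma primitive01_id : primitive01 (@idfun R) (fun=> 1).
Proof. by apply: primitive01_C1 => x; exact: cvg_cst. Qed.

Lemma L1M_continuous f g : {within `[0, 1], continuous f} -> L1 g ->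
  L1 (fun x => f x * g x).
Proof.
move=> cf g1; have cf' : {within `[0, 1], continuous (fun x => `|f x|)}.
  by move=> x; apply: cvg_norm; exact: cf.
have [c _ fc] := EVT_max (@ler01 R) cf'.
apply: (@L1_le _ _ (fun x => `|f c| * `|g x|)).
- apply: measurable_funM; last exact: L1_measurable.
  exact: L1_measurable (L1_continuous cf).
- by move=> x x01; rewrite normrM ler_wpM2r// fc// in_itv.
- exact/L1Z/L1_abs.
Qed.

(** Heine's theorem, by compactness in the form of near-coverings: the property
  with [d] holds for all [d] close enough to 0, locally uniformly. *)
Lemma within_continuous_unif a b f : {within `[a, b], continuous f} ->
  forall e, 0 < e -> exists2 d, 0 < d & forall x y,
    a <= x <= b -> a <= y <= b -> `|x - y| < d -> `|f x - f y| < e.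
Proof.
move=> cf e e0.
have /compact_near_coveringP cK := @segment_compact R a b.
pose P (d : R) (x : R) := a <= x <= b -> forall y, a <= y <= b ->
  `|x - y| < d -> `|f x - f y| < e.
have KP : \forall d \near 0^'+, `[a, b] `<=` P d.
  apply: (cK R (at_right 0) P) => x /= xab.
  have /subspace_continuousP/(_ x xab)/cvgrPdist_lt := cf.
  move=> /(_ (e / 2)); rewrite divr_gt0// => /(_ isT).
  rewrite near_withinE => -[r/= r0 Hr].
  exists (ball x (r / 2), [set d | d < r / 2]) => /=; first split.
  + by exists (r / 2) => //=; rewrite divr_gt0.
  + by apply: nbhs_right_lt; rewrite divr_gt0.
  move=> [x' d] /= [xx' dr] x'ab y yab x'y.
  have H1 : `|f x - f x'| < e / 2.
    apply: Hr; [rewrite /ball/= in xx' *; lra|by rewrite in_itv].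
  have H2 : `|f x - f y| < e / 2.
    apply: Hr; last by rewrite in_itv.
    rewrite /ball/= in xx' *.
    have := ler_distD x' x y; lra.
  have := ler_distD (f x) (f x') (f y); rewrite (distrC (f x') (f x)); lra.
near (0 : R)^'+ => d.
exists d; first by near: d; exact: nbhs_right_gt.
have dP : `[a, b] `<=` P d by near: d.
by move=> x y xab; apply: dP => //=; rewrite in_itv.
Unshelve. all: by end_near.
Qed.

(** Chaining steps of length [d / 2]: an increment bounded by [e] times that of
  [K] on all short intervals is so bounded on long ones, without any loss in
  [e]. *)
Lemma increment_local_global (P K : R -> R) a b d e : 0 < d -> a <= b ->
  (forall x y, a <= x -> x <= y -> y <= b -> y - x < d ->
    `|P y - P x| <= e * (K y - K x)) ->
  `|P b - P a| <= e * (K b - K a).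
Proof.
move=> d0 ab H.
have [n] : exists n : nat, b - a <= n%:R * (d / 2).
  exists (Num.bound ((b - a) / (d / 2))); rewrite -ler_pdivrMr; last lra.
  by apply/ltW/archi_boundP; rewrite divr_ge0//; lra.
elim: n b ab H => [|n IH] b ab H; rewrite ?mul0r.
  by move=> ba; apply: H => //; lra.
rewrite mulrSr mulrDl mul1r => bn.
have [bd|bd] := ltP (b - a) d; first exact: H.
have H1 : `|P (b - d / 2) - P a| <= e * (K (b - d / 2) - K a).
  apply: IH; [lra| |lra].
  by move=> x y ax xy yb yx; apply: H => //; lra.
have H2 : `|P b - P (b - d / 2)| <= e * (K b - K (b - d / 2)) by apply: H; lra.
have := ler_distD (P (b - d / 2)) (P b) (P a); lra.
Qed.

(** The product rule needs no differentiation: on an interval on which [F] and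
  [G] oscillate by less than [e], the increment of [F * G] differs from
  [\int (f G + F g)] by at most [e \int (|f| + |g|)].  These errors are additive
  in the interval, so the bound passes to [a, b] with [e] still arbitrary. *)
Lemma primitive01M F f G g : primitive01 F f -> primitive01 G g ->
  primitive01 (fun x => F x * G x) (fun x => f x * G x + F x * g x).
Proof.
move=> pF pG; have cF := primitive01_continuous pF.
have cG := primitive01_continuous pG.
have [f1 Ff] := pF; have [g1 Gg] := pG.
have FG1 : L1 (fun x => f x * G x + F x * g x).
  apply: L1D; last exact: L1M_continuous.
  by rewrite (_ : (fun _ => _) = (fun x => G x * f x));
    [exact: L1M_continuous|apply/funext => x; rewrite mulrC].
split => // a b a0 ab b1.
have K1 : L1 (fun x => `|f x| + `|g x|) by apply: L1D; exact: L1_abs.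
pose K x := \int[mu]_(t in `[0, x]) (`|f t| + `|g t|).
have [_ KE] : primitive01 K _ := primitive01_integral K1.
pose I x := \int[mu]_(t in `[0, x]) (f t * G t + F t * g t).
have [_ IE] : primitive01 I _ := primitive01_integral FG1.
pose P x := F x * G x - I x.
suff H e : 0 < e -> `|P b - P a| <= e * (K b - K a).
  rewrite -IE//; suff : `|P b - P a| <= 0.
    rewrite normr_le0 subr_eq0 => /eqP; rewrite /P /= => E; lra.
  have Kab : 0 <= K b - K a.
    by rewrite KE//; apply: Rintegral_ge0 => x _; rewrite addr_ge0.
  apply/ler_addgt0Pr => e e0; rewrite add0r.
  apply: (le_trans (H (e / (K b - K a + 1)) _)).
    by rewrite divr_gt0//; lra.
  rewrite -mulrA ler_piMr ?(ltW e0)// mulrC ler_pdivrMr; lra.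
move=> e0.
have [d d0 Hd] := within_continuous_unif cF e0.
have [d' d'0 Hd'] := within_continuous_unif cG e0.
apply: (@increment_local_global _ _ _ _ (Num.min d d')) => //.
  by rewrite lt_min d0.
move=> x y ax xy yb; rewrite lt_min => /andP[xyd xyd'].
have x0 : 0 <= x by lra. have y1 : y <= 1 by lra.
have -> : P y - P x = \int[mu]_(t in `[x, y])
    (f t * (G y - G t) + g t * (F x - F t)).
  have -> : P y - P x = (F y - F x) * G y + (G y - G x) * F x - (I y - I x).
    by rewrite /P; ring.
  rewrite IE// Ff// Gg//.
  rewrite -!RintegralZr//; [|exact: L1_sub..].
  rewrite -RintegralD//; last 2 first.
  - apply: L1_sub => //; rewrite -[X in L1 X]/(fun x => f x * G y).
    rewrite (_ : (fun _ => _) = (fun x => G y * f x)); first exact: L1Z.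
    by apply/funext => t; rewrite mulrC.
  - apply: L1_sub => //.
    rewrite (_ : (fun _ => _) = (fun t => F x * g t)); first exact: L1Z.
    by apply/funext => t; rewrite mulrC.
  rewrite -RintegralB//; last exact: L1_sub.
    by apply: eq_Rintegral => t _; ring.
  apply: L1_sub => //.
  rewrite (_ : (fun _ => _) = (fun t => G y * f t + F x * g t)).
    by apply: L1D; exact: L1Z.
  by apply/funext => t; ring.
have D1 : L1 (fun t => f t * (G y - G t) + g t * (F x - F t)).
  rewrite (_ : (fun _ => _) = (fun t => (G y * f t + F x * g t)
      - (f t * G t + F t * g t))).
    by apply: L1B => //; apply: L1D; exact: L1Z.
  by apply/funext => t; ring.
apply: (le_trans (le_normr_Rintegral _ _)) => //; first exact: L1_sub.
rewrite KE// -RintegralZl//; last exact: L1_sub.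
apply: le_Rintegral => //.
- by apply: L1_sub => //; exact: L1_abs.
- by apply: L1_sub => //; exact: L1Z.
move=> t /=; rewrite in_itv/= => /andP[xt ty].
have G' : `|G y - G t| <= e.
  by apply/ltW/Hd'; [lra|lra|rewrite ltr_norml; apply/andP; split; lra].
have F' : `|F x - F t| <= e.
  by apply/ltW/Hd; [lra|lra|rewrite ltr_norml; apply/andP; split; lra].
apply: (le_trans (ler_normD _ _)); rewrite !normrM.
have := ler_wpM2l (normr_ge0 (f t)) G'; have := ler_wpM2l (normr_ge0 (g t)) F'.
lra.
Qed.

Lemma inner_ibp f f' g g' : primitive01 f f' -> primitive01 g g' ->
  sqint f' -> sqint g' ->
  inner f' g + inner f g' = f 1 * g 1 - f 0 * g 0.
Proof.
move=> pf pg sf' sg'; have := primitive01_int01 (primitive01M pf pg).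
have sf := primitive01_sqint pf; have sg := primitive01_sqint pg.
by rewrite int01D//; exact: sqint_L1M.
Qed.

(** The multiplier identity [2 \int x f' f = f(1)^2 - \int f^2], used both for
  [e_t] and for [e_x]. *)
Lemma inner_ibp_mulx f f' : primitive01 f f' -> sqint f' ->
  inner f f + 2 * inner (fun x => x * f' x) f = f 1 ^+ 2.
Proof.
move=> pf sf'; have sf := primitive01_sqint pf.
have pxf := primitive01M primitive01_id pf.
have sxf' := sqint_mulx sf'.
have sxf : sqint (fun x => 1 * f x + x * f' x).
  by apply: sqintD => //; exact: sqintZ.
have := inner_ibp pxf pf sxf sf'.
rewrite /= mul0r mul0r subr0 mul1r -expr2 => <-.
rewrite innerDl//; last exact: sqintZ.
rewrite innerZl// mul1r.
have -> : inner (fun x => x * f x) f' = inner (fun x => x * f' x) f.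
  by congr int01; apply/funext => x /=; ring.
ring.
Qed.

End primitives.

(** * Weak derivatives *)

Section weak_derivatives.
Context {R : realType}.
Local Notation mu := (@lebesgue_measure R).
Implicit Types (f F G : R -> R) (a b c d e l w u x y : R).

Lemma is_derive_quadratic_bound f x d :
  (forall y, `|f y - f x - d * (y - x)| <= (y - x) ^+ 2) -> is_derive x 1 f d.
Proof.
move=> H.
have C : h^-1 *: (f (h *: 1 + x) - f x) @[h --> 0^'] --> d.
  apply/cvgrPdist_lt => e e0; near=> h.
  have h0 : h != 0 by near: h; exact: nbhs_dnbhs_neq.
  have he : `|h| < e.
    near: h; apply: dnbhs0_lt => //.
  have := H (h + x); rewrite addrK => Hh.
  have -> : d - h^-1 *: (f (h *: 1 + x) - f x) =
      h^-1 * (- (f (h + x) - f x - d * h)).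
    rewrite /GRing.scale/= mulr1; field; exact: h0.
  suff : `|h^-1 * - (f (h + x) - f x - d * h)| < e; first exact.
  rewrite normrM normrN; apply: le_lt_trans he.
  rewrite normfV ler_pdivrMl ?normr_gt0//.
  by rewrite -expr2 real_normK// num_real.
split; first by apply/cvg_ex; exists d.
exact: cvg_lim.
Unshelve. all: by end_near.
Qed.

Definition sqpos (x : R) : R := Num.max 0 x ^+ 2.

Lemma is_derive_sqpos (x : R) : is_derive x 1 sqpos (2 * Num.max 0 x).
Proof.
apply: is_derive_quadratic_bound => y; rewrite /sqpos.
rewrite ler_norml; apply/andP; have := sqr_ge0 (y - x).
by case: (ltP 0 x) => hx; case: (ltP 0 y) => hy; split; nra.
Qed.

(** A step of class C^1, from 0 for [u <= 0] to 1 for [2 * w <= u], obtained as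
  a normalised second difference of [sqpos]; [tent] is its derivative, an
  approximation of the Dirac mass. *)
Definition step (w u : R) : R :=
  (sqpos u - 2 * sqpos (u - w) + sqpos (u - 2 * w)) / (2 * w ^+ 2).

Definition tent (w u : R) : R :=
  (Num.max 0 u - 2 * Num.max 0 (u - w) + Num.max 0 (u - 2 * w)) / w ^+ 2.

Lemma is_derive_step w c (x : R) : 0 < w ->
  is_derive x 1 (fun x => step w (x - c)) (tent w (x - c)).
Proof.
move=> w0; have D d :
    is_derive x 1 (fun y => sqpos (y - d)) (2 * Num.max 0 (x - d)).
  have H1 : is_derive (x - d) 1 sqpos (2 * Num.max 0 (x - d)).
    exact: is_derive_sqpos.
  have H2 : is_derive x 1 (fun y => y - d) 1.
    by apply: is_derive_eq; rewrite subr0.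
  by apply: is_derive_eq; rewrite mulr1.
have -> : (fun x => step w (x - c)) =
    (2 * w ^+ 2)^-1 *: ((fun y => sqpos (y - c)) -
      2 *: (fun y => sqpos (y - (c + w))) + (fun y => sqpos (y - (c + 2 * w)))).
  by apply/funext => y /=; rewrite /step !fctE !opprD !addrA mulrC.
apply: is_derive_eq; rewrite /tent /GRing.scale/= !opprD !addrA.
by field; lra.
Qed.

Lemma continuous_tent w c : continuous (fun x => tent w (x - c)).
Proof.
have C d : continuous (fun x : R => Num.max 0 (x - d)).
  move=> x; apply: (@continuous_max _ _ (cst 0) (fun x : R => x - d)).
    exact: cvg_cst.
  by apply: cvgB; [exact: cvg_id|exact: cvg_cst].
have -> : (fun x => tent w (x - c)) =
  (fun y => (Num.max 0 (y - c) - 2 * Num.max 0 (y - (c + w))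
      + Num.max 0 (y - (c + 2 * w))) / w ^+ 2).
  by apply/funext => y; rewrite /tent !opprD !addrA.
move=> x; apply: cvgM; last exact: cvg_cst.
apply: cvgD; last exact: C.
apply: cvgB; first exact: C.
by apply: cvgM; [exact: cvg_cst|exact: C].
Qed.

Lemma tent_ge0 w u : 0 < w -> 0 <= tent w u.
Proof.
move=> w0; rewrite /tent divr_ge0 ?sqr_ge0//.
by case: (ltP 0 u); case: (ltP 0 (u - w)); case: (ltP 0 (u - 2 * w)); lra.
Qed.

Lemma tent_eq0 w u : 0 < w -> ~~ (0 <= u <= 2 * w) -> tent w u = 0.
Proof.
move=> w0 uw; rewrite /tent.
suff -> : Num.max 0 u - 2 * Num.max 0 (u - w) + Num.max 0 (u - 2 * w) = 0.
  by rewrite mul0r.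
move: uw; case: (ltP 0 u); case: (ltP 0 (u - w)); case: (ltP 0 (u - 2 * w));
  lra.
Qed.

Lemma step_eq0 w u : 0 < w -> u <= 0 -> step w u = 0.
Proof.
move=> w0 u0; rewrite /step /sqpos.
by case: (ltP 0 u); case: (ltP 0 (u - w)); case: (ltP 0 (u - 2 * w));
  rewrite ?expr0n/= ?mulr0 ?subr0 ?addr0 ?mul0r//; lra.
Qed.

Lemma step_eq1 w u : 0 < w -> 2 * w <= u -> step w u = 1.
Proof.
move=> w0 u0; rewrite /step /sqpos.
have -> : Num.max 0 u = u by apply/max_idPr; lra.
have -> : Num.max 0 (u - w) = u - w by apply/max_idPr; lra.
have -> : Num.max 0 (u - 2 * w) = u - 2 * w by apply/max_idPr; lra.
by field; lra.
Qed.

Lemma step_01 w u : 0 < w -> 0 <= step w u <= 1.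
Proof.
move=> w0; rewrite /step /sqpos ler_pdivlMr ?ler_pdivrMr; [|nra..].
rewrite mul0r mul1r; apply/andP.
by case: (ltP 0 u); case: (ltP 0 (u - w)); case: (ltP 0 (u - 2 * w));
  split; nra.
Qed.

Lemma within_continuous_tent w c (A : set R) :
  {within A, continuous (fun x => tent w (x - c))}.
Proof. exact: continuous_subspaceT (@continuous_tent w c). Qed.

Lemma int01_tent w c : 0 < w -> 0 <= c -> c + 2 * w <= 1 ->
  int01 (fun x => tent w (x - c)) = 1.
Proof.
move=> w0 c0 cw.
have /primitive01_int01 -> : primitive01 (fun x => step w (x - c))
    (fun x => tent w (x - c)).
  apply: primitive01_C1; last exact: within_continuous_tent.
  by move=> x _; exact: is_derive_step.
by rewrite step_eq1 ?step_eq0 ?subr0//; lra.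
Qed.

Lemma L1_tentM w c F : {within `[0, 1], continuous F} ->
  L1 (fun x => F x * tent w (x - c)).
Proof.
move=> cF; apply: L1_continuous; apply: within_continuousM => //.
exact: within_continuous_tent.
Qed.

(** [tent w (x - c)] is a probability density on [c, c + 2 * w]. *)
Lemma int01_tent_average w c F l e : 0 < w -> 0 <= c -> c + 2 * w <= 1 ->
  {within `[0, 1], continuous F} ->
  (forall x, c <= x <= c + 2 * w -> `|F x - l| <= e) ->
  `|int01 (fun x => F x * tent w (x - c)) - l| <= e.
Proof.
move=> w0 c0 cw cF Fl.
have T1 : L1 (fun x => tent w (x - c)).
  exact/L1_continuous/within_continuous_tent.
have FT := L1_tentM w c cF.
have -> : int01 (fun x => F x * tent w (x - c)) - l =
    int01 (fun x => F x * tent w (x - c) - l * tent w (x - c)).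
  by rewrite int01B ?int01Z ?int01_tent ?mulr1//; exact: L1Z.
have FlT : L1 (fun x => F x * tent w (x - c) - l * tent w (x - c)).
  by apply: L1B => //; exact: L1Z.
apply: le_trans (le_normr_Rintegral _ FlT) _ => //.
rewrite [leRHS](_ : e = int01 (fun x => e * tent w (x - c))); last first.
  by rewrite int01Z// int01_tent// mulr1.
apply: (le_int01 (L1_abs FlT)); first exact: L1Z.
move=> x _; rewrite -mulrBl normrM (ger0_norm (tent_ge0 _ w0)).
have [xc|xc] := boolP (0 <= x - c <= 2 * w).
  by rewrite ler_wpM2r ?tent_ge0// Fl//; lra.
by rewrite tent_eq0// !mulr0.
Qed.

Lemma int01_indic a b : 0 <= a -> a <= b -> b <= 1 ->
  int01 (\1_`[a, b] : R -> R) = b - a.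
Proof.
move=> a0 ab b1; rewrite /int01 /Rintegral integral_indic//.
rewrite (_ : (`[a, b] `&` `[0, 1])%classic = `[a, b]%classic).
  rewrite [X in fine X](lebesgue_measure_itv `[a, b])/= lte_fin.
  by have [//|] := ltP a b; rewrite /= => ba; lra.
apply/setIidPl => x /=; rewrite !in_itv/= => /andP[ax xb].
by rewrite (le_trans a0 ax) (le_trans xb b1).
Qed.

Lemma L1_indic a b : L1 (\1_`[a, b] : R -> R).
Proof.
apply: (@L1_le _ _ (fun=> 1)).
- exact: measurable_indic.
- by move=> x _; rewrite /indic; case: (x \in _); rewrite ?normr1 ?normr0.
- exact: sqint_L1 sqint1.
Qed.

Lemma L1_mul_indic G a b : L1 G -> L1 (fun x => G x * \1_`[a, b] x).
Proof.
move=> G1; apply: (@L1_le _ _ (fun x => `|G x|)); last exact: L1_abs.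
  by apply: measurable_funM; [exact: L1_measurable|exact: measurable_indic].
by move=> x _; rewrite indicE; case: (_ \in _); rewrite ?mulr1 ?mulr0 ?normr0.
Qed.

Lemma Rintegral_int01 G a b : 0 <= a -> b <= 1 ->
  \int[mu]_(x in `[a, b]) G x = int01 (fun x => G x * \1_`[a, b] x).
Proof.
move=> a0 b1; rewrite /int01.
rewrite (_ : `[a, b]%classic = (`[0, 1] `&` `[a, b])%classic); last first.
  apply/esym/setIidPr => x /=; rewrite !in_itv/= => /andP[ax xb].
  by rewrite (le_trans a0 ax) (le_trans xb b1).
rewrite Rintegral_mkcondr; apply: eq_Rintegral => x; rewrite inE/= => x01.
have x01' : x \in `[0, 1]%classic by rewrite mem_set.
by rewrite /patch indicE in_setI x01' /=; case: ifP; rewrite ?mulr1 ?mulr0.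
Qed.

(** A test function approximating the indicator of [a, b]; it is shifted inwards
  by [w], so that its support avoids the end points even if these are 0 and
  1. *)
Definition bump w a b x : R := step w (x - (a + w)) - step w (x - (b - 3 * w)).

Lemma is_derive_bump w a b x : 0 < w -> is_derive x 1 (bump w a b)
  (tent w (x - (a + w)) - tent w (x - (b - 3 * w))).
Proof.
move=> w0.
have H1 := is_derive_step (a + w) x w0.
have H2 := is_derive_step (b - 3 * w) x w0.
rewrite /bump.
exact: (is_deriveB H1 H2).
Qed.

Lemma derive1_bump w a b : 0 < w -> derive1 (bump w a b) =
  (fun x => tent w (x - (a + w)) - tent w (x - (b - 3 * w))).
Proof.
move=> w0; apply/funext => x; rewrite derive1E.
by have /@derive_val := is_derive_bump a b x w0.
Qed.

Lemma bump_test_function w a b : 0 < w -> 0 <= a -> b <= 1 ->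
  a + 6 * w <= b -> test_function (bump w a b).
Proof.
move=> w0 a0 b1 wab; split.
- by move=> x; have [] := is_derive_bump a b x w0.
- rewrite derive1_bump// => x.
  by apply: cvgB; exact: continuous_tent.
have aw : 0 < a + w by lra.
have bw : b - w < 1 by lra.
exists (a + w), (b - w); split => // x.
apply: contraNT; rewrite negb_and -!ltNge => /orP[] h; apply/eqP; rewrite /bump.
  by rewrite !step_eq0 ?subr0//; lra.
by rewrite !step_eq1 ?subrr//; lra.
Qed.

(** The two functions differ only at distance at most [3 * w] from [a] or [b],
  and inside [a, b], by at most 1. *)
Lemma bump_indic w a b x : 0 < w -> a + 6 * w <= b ->
  (bump w a b x - \1_`[a, b] x) ^+ 2 <=
  \1_`[a, a + 3 * w] x + \1_`[b - 3 * w, b] x.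
Proof.
move=> w0 wab; rewrite !indicE !mem_setE !in_itv/=.
have /andP[A0 A1] := step_01 (x - (a + w)) w0.
have /andP[B0 B1] := step_01 (x - (b - 3 * w)) w0.
have A2 : x <= a + w -> step w (x - (a + w)) = 0.
  by move=> h; rewrite step_eq0//; lra.
have A3 : a + 3 * w <= x -> step w (x - (a + w)) = 1.
  by move=> h; rewrite step_eq1//; lra.
have B2 : x <= b - 3 * w -> step w (x - (b - 3 * w)) = 0.
  by move=> h; rewrite step_eq0//; lra.
have B3 : b - w <= x -> step w (x - (b - 3 * w)) = 1.
  by move=> h; rewrite step_eq1//; lra.
rewrite /bump.
have [xa|ax] := ltP x a.
  rewrite A2; last lra. rewrite B2; last lra.
  by rewrite /= subrr subr0 expr0n addr_ge0.
have [xb|bx] := ltP b x.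
  rewrite A3; last lra. rewrite B3; last lra.
  by rewrite /= andbF subrr subr0 expr0n addr_ge0.
rewrite /=.
have [x1|x1] := lerP x (a + 3 * w).
  rewrite B2; last lra.
  have : 0 <= (((b - 3 * w <= x) && true)%:R : R) by [].
  rewrite -[(true && true)%:R]/(1 : R); nra.
have [x2|x2] := lerP (b - 3 * w) x.
  rewrite A3; last lra.
  by rewrite /=; nra.
rewrite A3; last lra. rewrite B2; last lra.
by rewrite /=; lra.
Qed.

Lemma sqint_bump_indic w a b : 0 < w -> a + 6 * w <= b ->
  sqint (fun x => bump w a b x - \1_`[a, b] x).
Proof.
move=> w0 wab.
have mB : measurable_fun (`[0, 1] : set R)
    (fun x => bump w a b x - \1_`[a, b] x).
  apply: measurable_funB; last exact: measurable_indic.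
  apply: L1_measurable; apply: L1_continuous.
  apply: continuous_subspaceT => x.
  apply/differentiable_continuous/derivable1_diffP.
  by case: (is_derive_bump a b x w0).
split => //.
apply: (@L1_le _ _ (fun x => \1_`[a, a + 3 * w] x + \1_`[b - 3 * w, b] x)).
- exact: measurable_funX.
- by move=> x _; rewrite ger0_norm ?sqr_ge0// bump_indic.
- by apply: L1D; exact: L1_indic.
Qed.

Lemma inner_bump_indic w a b : 0 < w -> 0 <= a -> b <= 1 -> a + 6 * w <= b ->
  inner (fun x => bump w a b x - \1_`[a, b] x)
    (fun x => bump w a b x - \1_`[a, b] x) <= 6 * w.
Proof.
move=> w0 a0 b1 wab.
apply: (@le_trans _ _
  (int01 (fun x => \1_`[a, a + 3 * w] x + \1_`[b - 3 * w, b] x))).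
  apply: le_int01 => [||x _].
  - by case: (sqint_bump_indic w0 wab).
  - by apply: L1D; exact: L1_indic.
  - exact: bump_indic.
rewrite int01D; [|exact: L1_indic..].
by rewrite !int01_indic; lra.
Qed.

(** Testing against [bump w a b]: as [w] tends to 0, [\int F bump'] tends to
  [F a - F b] because [bump'] is a difference of two approximate Dirac masses
  and [F] is continuous, while [\int G bump] tends to [\int_a^b G], with an
  error of order [sqrt w] by the Cauchy-Schwarz inequality. *)
Lemma W12_primitive F G : W12_deriv F G -> primitive01 F G.
Proof.
move=> [_ /in_L2_sqint sG FG cF]; have G1 := sqint_L1 sG.
split=> // a b a0; rewrite le_eqVlt => /predU1P[<- _|ab b1].
  by rewrite set_itv1 Rintegral_set1 subrr.
rewrite Rintegral_int01//; set I := int01 _.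
suff H e : 0 < e -> `|F b - F a - I| <= 3 * e.
  apply/eqP; rewrite -subr_eq0 -normr_le0; apply/ler_addgt0Pr => e e0.
  by rewrite add0r; have := H (e / 3); rewrite mulrCA divff// mulr1; apply; lra.
move=> e0; have [d d0 Hd] := within_continuous_unif cF e0.
set A := inner G G; have A0 : 0 <= A := inner_ge0 G.
(* [3 * w < d] controls the averages, [6 * w * A <= e ^+ 2] the other error *)
pose w := Num.min ((b - a) / 6) (Num.min (d / 6) (e ^+ 2 / (6 * (A + 1)))).
have w0 : 0 < w by rewrite !lt_min !divr_gt0//; nra.
have w1 : w <= (b - a) / 6 by rewrite !ge_min lexx.
have w2 : w <= d / 6 by rewrite !ge_min lexx orbT.
have w3 : w <= e ^+ 2 / (6 * (A + 1)) by rewrite !ge_min lexx !orbT.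
have wab : a + 6 * w <= b by lra.
have := FG _ (bump_test_function w0 a0 b1 wab).
rewrite derive1_bump//.
have -> : int01 (fun x => F x * (tent w (x - (a + w))
      - tent w (x - (b - 3 * w)))) =
    int01 (fun x => F x * tent w (x - (a + w))) -
    int01 (fun x => F x * tent w (x - (b - 3 * w))).
  by rewrite -int01B; [congr int01; apply/funext => x; ring|exact: L1_tentM..].
have Ta : `|int01 (fun x => F x * tent w (x - (a + w))) - F a| <= e.
  apply: int01_tent_average => //; [lra|lra|move=> x xa].
  by apply/ltW/Hd; [lra|lra|rewrite ltr_norml; apply/andP; split; lra].
have Tb : `|int01 (fun x => F x * tent w (x - (b - 3 * w))) - F b| <= e.
  apply: int01_tent_average => //; [lra|lra|move=> x xa].
  by apply/ltW/Hd; [lra|lra|rewrite ltr_norml; apply/andP; split; lra].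
have sB := sqint_bump_indic w0 wab.
have Gi := L1_mul_indic a b G1.
have -> : int01 (fun x => G x * bump w a b x) =
    int01 (fun x => G x * (bump w a b x - \1_`[a, b] x)) + I.
  rewrite -int01D//; last exact: sqint_L1M.
  by congr int01; apply/funext => x; ring.
have TG : `|int01 (fun x => G x * (bump w a b x - \1_`[a, b] x))| <= e.
  rewrite -(@ler_pXn2r _ 2) ?nnegrE ?(ltW e0)// real_normK ?num_real//.
  apply: (le_trans (inner_CauchySchwarz sG sB)).
  have := inner_bump_indic w0 a0 b1 wab; set C := inner _ _ => HC.
  have : w * (6 * (A + 1)) <= e ^+ 2 by rewrite -ler_pdivlMr//; lra.
  rewrite -/A; nra.
move: Ta Tb TG; rewrite !ler_norml => /andP[? ?] /andP[? ?] /andP[? ?] ?.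
by apply/andP; split; lra.
Qed.

End weak_derivatives.

(** * The sharp Poincare inequality *)

Section poincare.
Context {R : realType}.
Implicit Types (f g : R -> R) (d e w x : R).

(** The function [c x = w tan (w (1 - x))] solves the Riccati equation
  [c' = - w^2 - c^2] with [c 1 = 0].  As [f 0 = 0], the integral of [(c f^2)']
  vanishes, whence [\int (g - c f)^2 = \int g^2 - w^2 \int f^2].  For
  [w < pi / 2], [c] is smooth on [0, 1], so that no singular boundary term
  appears. *)
Lemma poincare_lt f g w : primitive01 f g -> sqint g -> f 0 = 0 ->
  0 < w -> w < pi / 2 ->
  w ^+ 2 * inner f f <= inner g g.
Proof.
move=> pf sg f0 w0 wpi.
pose c x := w * tan (w * (1 - x)).
have cx x : 0 <= x <= 1 -> cos (w * (1 - x)) != 0.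
  move=> /andP[x0 x1]; rewrite gt_eqF// cos_gt0_pihalf//.
  by apply/andP; split; nra.
have dc x : 0 <= x <= 1 -> is_derive x 1 c (- w ^+ 2 - c x ^+ 2).
  move=> x01; have H := is_derive_tan (cx _ x01).
  rewrite /c; have H2 : is_derive x 1 (fun y => w * (1 - y)) (- w).
    by apply: is_derive_eq; rewrite /GRing.scale/= ; ring.
  have H3 : is_derive x 1 (fun y => tan (w * (1 - y)))
      (- w * (cos (w * (1 - x))) ^- 2).
    by apply: is_derive_eq; rewrite /GRing.scale/= ; ring.
  apply: is_derive_eq; rewrite /GRing.scale/= cos2_tan2 ?cx//; ring.
have cc : {within `[0, 1], continuous c}.
  apply: derivable_within_continuous => x; rewrite in_itv/= => /dc H.
  by case: H.
have pc : primitive01 c (fun x => - w ^+ 2 - c x ^+ 2).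
  apply: primitive01_C1 => // x; apply: cvgB; first exact: cvg_cst.
  exact: (within_continuousM cc cc).
have pcff := primitive01M pc (primitive01M pf pf).
have := primitive01_int01 pcff.
have -> : c 1 = 0 by rewrite /c subrr mulr0 tan0 mulr0.
rewrite f0 !(mul0r, mulr0) subrr => E.
rewrite -subr_ge0; have sf := primitive01_sqint pf.
have [[_ f2] [_ g2]] := (sf, sg).
have <- : int01 (fun x => g x ^+ 2 - w ^+ 2 * f x ^+ 2) =
    inner g g - w ^+ 2 * inner f f by rewrite int01B ?int01Z//; exact: L1Z.
rewrite -E; apply: le_int01; [by case: pcff|by apply: L1B => //; exact: L1Z|].
move=> x _; have := sqr_ge0 (g x - c x * f x); lra.
Qed.

Lemma poincare f g : primitive01 f g -> sqint g -> f 0 = 0 ->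
  inner f f <= 4 / pi ^+ 2 * inner g g.
Proof.
move=> pf sg f0; set A := inner f f; set B := inner g g.
have A0 : 0 <= A := inner_ge0 f.
have pi0 : 0 < pi :> R := pi_gt0 R.
suff : (pi / 2) ^+ 2 * A <= B.
  move=> H; rewrite mulrAC ler_pdivlMr ?exprn_gt0//; lra.
(* [w = pi / 2 - d] with [d] tending to 0 *)
apply/ler_addgt0Pr => e e0.
pose d := Num.min (pi / 4) (e / (pi * (A + 1))).
have d0 : 0 < d by rewrite lt_min !divr_gt0//; nra.
have d1 : d <= pi / 4 by rewrite ge_min lexx.
have d2 : d * (pi * (A + 1)) <= e.
  by rewrite -ler_pdivlMr ?ge_min ?lexx ?orbT//; nra.
have := @poincare_lt f g (pi / 2 - d) pf sg f0.
rewrite -/A -/B => H.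
have {}H : (pi / 2 - d) ^+ 2 * A <= B by apply: H; lra.
have : 0 <= d * pi by nra.
nra.
Qed.

End poincare.

(** * Curves of square integrable functions *)

Section curves.
Context {R : realType}.
Implicit Types (f g h : R -> R) (F G : R -> R -> R) (T : \bar R)
  (a b c d e s t x y : R) (V W : R -> R).

(** The error in the approximation of a derivative by a difference quotient. *)
Definition quot_error F F' t s x : R := (s - t)^-1 * (F s x - F t x) - F' t x.

(** Differentiability in the norm of L_2, stated with the squared norm because
  it is an integral. *)
Definition L2diff T F F' : Prop :=
  [/\ forall t, time_dom T t -> sqint (F t),
      forall t, time_dom T t -> sqint (F' t) &
      forall t, time_dom T t ->
        inner (quot_error F F' t s) (quot_error F F' t s)
          @[s --> within (time_dom T) t^'] --> (0 : R)].

(** Differentiability of a function of time along the time domain, hence on the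
  right only at time 0. *)
Definition has_derivative T V V' : Prop := forall t, time_dom T t ->
  (s - t)^-1 * (V s - V t) @[s --> within (time_dom T) t^'] --> (V' t : R).

Lemma sqint_quot_error T F F' t s : L2diff T F F' -> time_dom T t ->
  time_dom T s -> sqint (quot_error F F' t s).
Proof.
move=> [sF sF' _] dt ds; apply: sqintB; last exact: sF'.
by apply: sqintZ; apply: sqintB; exact: sF.
Qed.

Lemma near_within_self (A : set R) t : \forall s \near within A t^', A s.
Proof. by rewrite near_withinE; apply: nearW. Qed.

Lemma near_within_neq (A : set R) t : \forall s \near within A t^', s - t != 0.
Proof.
rewrite near_withinE; near=> s => _; rewrite subr_eq0; near: s.
exact: nbhs_dnbhs_neq.
Unshelve. all: by end_near.
Qed.

Lemma L2_derivative_L2diff T F F' :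
  (forall t, time_dom T t -> sqint (F t)) ->
  (forall t, time_dom T t -> sqint (F' t)) ->
  L2_derivative T F F' -> L2diff T F F'.
Proof.
move=> sF sF' FF'; split => // t dt.
have L : L2norm (quot_error F F' t s) * L2norm (quot_error F F' t s)
    @[s --> within (time_dom T) t^'] --> (0 : R).
  by rewrite -[X in _ --> X](mulr0 0); apply: cvgM; exact: FF'.
apply: (cvg_trans _ L); apply: near_eq_cvg; near=> s.
rewrite /= -expr2 L2normX2//.
have ds : time_dom T s by near: s; exact: (near_within_self (time_dom T) t).
by apply: sqintB; [apply: sqintZ; apply: sqintB; exact: sF|exact: sF'].
Unshelve. all: by end_near.
Qed.

Lemma L2diff_cvg0 T F F' t : L2diff T F F' -> time_dom T t ->
  forall e, 0 < e -> \forall s \near within (time_dom T) t^',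
    inner (quot_error F F' t s) (quot_error F F' t s) < e.
Proof.
move=> [_ _ H] dt e e0; have /cvgrPdist_lt/(_ e e0) := H t dt.
apply: filterS => s; rewrite sub0r normrN ger0_norm//; exact: inner_ge0.
Qed.

Lemma L2diffB T F F' G G' : L2diff T F F' -> L2diff T G G' ->
  L2diff T (fun t x => F t x - G t x) (fun t x => F' t x - G' t x).
Proof.
move=> DF DG; have [sF sF' _] := DF; have [sG sG' _] := DG.
split => [t dt|t dt|t dt].
- by apply: sqintB; [exact: sF|exact: sG].
- by apply: sqintB; [exact: sF'|exact: sG'].
apply/cvgrPdist_lt => e e0; have e4 : 0 < e / 4 by lra.
near=> s.
have ds : time_dom T s by near: s; exact: (near_within_self (time_dom T) t).
have H1 : inner (quot_error F F' t s) (quot_error F F' t s) < e / 4.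
  by near: s; exact: (L2diff_cvg0 DF dt e4).
have H2 : inner (quot_error G G' t s) (quot_error G G' t s) < e / 4.
  by near: s; exact: (L2diff_cvg0 DG dt e4).
rewrite sub0r normrN ger0_norm; last exact: inner_ge0.
have -> : quot_error (fun t x => F t x - G t x)
      (fun t x => F' t x - G' t x) t s =
    (fun x => quot_error F F' t s x - quot_error G G' t s x).
  by apply/funext => x; rewrite /quot_error; ring.
have sqF := sqint_quot_error DF dt ds; have sqG := sqint_quot_error DG dt ds.
rewrite innerBl ?(innerBr sqF sqG)//; last exact: sqintB.
rewrite (innerC (quot_error G G' t s) (quot_error F F' t s)).
have := inner_ge0 (fun x => quot_error F F' t s x + quot_error G G' t s x).
rewrite innerDl ?(innerDr sqF sqG)//; last exact: sqintD.
rewrite (innerC (quot_error G G' t s) (quot_error F F' t s)).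
lra.
Unshelve. all: by end_near.
Qed.

Lemma L2diff_mulx T F F' : L2diff T F F' ->
  L2diff T (fun t x => x * F t x) (fun t x => x * F' t x).
Proof.
move=> DF; have [sF sF' H] := DF.
split => [t dt|t dt|t dt]; [exact/sqint_mulx/sF|exact/sqint_mulx/sF'|].
apply/cvgrPdist_lt => e e0; near=> s.
have ds : time_dom T s by near: s; exact: (near_within_self (time_dom T) t).
have H1 : inner (quot_error F F' t s) (quot_error F F' t s) < e.
  by near: s; exact: (L2diff_cvg0 DF dt e0).
rewrite sub0r normrN ger0_norm; last exact: inner_ge0.
have -> : quot_error (fun t x => x * F t x) (fun t x => x * F' t x) t s =
    (fun x => x * quot_error F F' t s x).
  by apply/funext => x; rewrite /quot_error; ring.
have sq := sqint_quot_error DF dt ds; have sxq := sqint_mulx sq.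
apply: le_lt_trans H1; apply: le_int01; [exact: sqint_L1M..|].
move=> x /andP[x0 x1]; rewrite -!expr2 exprMn ler_piMl ?sqr_ge0//.
by rewrite expr_le1.
Unshelve. all: by end_near.
Qed.

Lemma inner_cvg0 T F F' t g : L2diff T F F' -> time_dom T t -> sqint g ->
  inner (quot_error F F' t s) g @[s --> within (time_dom T) t^'] --> (0 : R).
Proof.
move=> DF dt sg; have g0 := inner_ge0 g.
apply/cvgrPdist_lt => e e0; near=> s.
have ds : time_dom T s by near: s; exact: (near_within_self (time_dom T) t).
have H1 : inner (quot_error F F' t s) (quot_error F F' t s) <
    e ^+ 2 / (inner g g + 1).
  near: s; apply: (L2diff_cvg0 DF dt).
  by rewrite divr_gt0 ?exprn_gt0//; lra.
rewrite sub0r normrN -(@ltr_pXn2r _ 2) ?nnegrE ?(ltW e0)//.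
rewrite real_normK ?num_real//.
apply: le_lt_trans (inner_CauchySchwarz (sqint_quot_error DF dt ds) sg) _.
move: H1; rewrite ltr_pdivlMr; last lra.
have := inner_ge0 (quot_error F F' t s); nra.
Unshelve. all: by end_near.
Qed.

Lemma inner_quot_errors_cvg0 T F F' G G' t : L2diff T F F' -> L2diff T G G' ->
  time_dom T t ->
  inner (quot_error F F' t s) (quot_error G G' t s)
    @[s --> within (time_dom T) t^'] --> (0 : R).
Proof.
move=> DF DG dt; apply/cvgrPdist_lt => e e0; near=> s.
have ds : time_dom T s by near: s; exact: (near_within_self (time_dom T) t).
have H1 : inner (quot_error F F' t s) (quot_error F F' t s) < e.
  by near: s; exact: (L2diff_cvg0 DF dt e0).
have H2 : inner (quot_error G G' t s) (quot_error G G' t s) < e.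
  by near: s; exact: (L2diff_cvg0 DG dt e0).
rewrite sub0r normrN -(@ltr_pXn2r _ 2) ?nnegrE ?(ltW e0)//.
rewrite real_normK ?num_real//.
have sqF := sqint_quot_error DF dt ds; have sqG := sqint_quot_error DG dt ds.
apply: le_lt_trans (inner_CauchySchwarz sqF sqG) _.
have := inner_ge0 (quot_error F F' t s).
have := inner_ge0 (quot_error G G' t s); nra.
Unshelve. all: by end_near.
Qed.

(** Substituting [F s = F t + (s - t) (F' t + error)] and the same for [G], and
  expanding the inner product, leaves terms that tend to 0. *)
Lemma inner_derivative T F F' G G' : L2diff T F F' -> L2diff T G G' ->
  has_derivative T (fun t => inner (F t) (G t))
    (fun t => inner (F' t) (G t) + inner (F t) (G' t)).
Proof.
move=> DF DG t dt; have [sF sF' _] := DF; have [sG sG' _] := DG.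
have [Ft F't Gt G't] := And4 (sF t dt) (sF' t dt) (sG t dt) (sG' t dt).
pose r s := inner (quot_error F F' t s) (G t) +
  inner (quot_error G G' t s) (F t) +
  (s - t) * (inner (F' t) (G' t) + inner (quot_error F F' t s) (G' t) +
    inner (quot_error G G' t s) (F' t) +
    inner (quot_error F F' t s) (quot_error G G' t s)).
have r0 : r s @[s --> within (time_dom T) t^'] --> (0 : R).
  have -> : 0 = 0 + 0 + (t - t) * (inner (F' t) (G' t) + 0 + 0 + 0) :> R.
    by ring.
  apply: cvgD; first by apply: cvgD; exact: inner_cvg0.
  apply: cvgM.
    apply: cvgB; last exact: cvg_cst.
    by apply: cvg_within_filter; apply: cvg_within_filter; exact: cvg_id.
  apply: cvgD; last exact: inner_quot_errors_cvg0.
  apply: cvgD; last exact: inner_cvg0.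
  by apply: cvgD; [exact: cvg_cst|exact: inner_cvg0].
have : inner (F' t) (G t) + inner (F t) (G' t) + r s
    @[s --> within (time_dom T) t^'] -->
    inner (F' t) (G t) + inner (F t) (G' t).
  by rewrite -[X in _ --> X]addr0; apply: cvgD => //; exact: cvg_cst.
move=> L; apply: (cvg_trans _ L); apply: near_eq_cvg; near=> s.
have ds : time_dom T s by near: s; exact: (near_within_self (time_dom T) t).
have st : s - t != 0 by near: s; exact: (near_within_neq (time_dom T) t).
have sqF := sqint_quot_error DF dt ds; have sqG := sqint_quot_error DG dt ds.
have FE : F s = (fun x => F t x + (s - t) * (F' t x + quot_error F F' t s x)).
  by apply/funext => x; rewrite /quot_error; field.
have GE : G s = (fun x => G t x + (s - t) * (G' t x + quot_error G G' t s x)).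
  by apply/funext => x; rewrite /quot_error; field.
have s1 := sqintD F't sqF; have s2 := sqintD G't sqG.
have s3 := sqintZ (s - t) s1; have s4 := sqintZ (s - t) s2.
have -> : inner (F s) (G s) = inner (F t) (G t) + (s - t) *
    (inner (F' t) (G t) + inner (F t) (G' t) + r s).
  have E k : sqint k -> inner k (G s) = inner k (G t) + (s - t) *
      (inner k (G' t) + inner k (quot_error G G' t s)).
    by move=> sk; rewrite GE innerDr// innerZr// innerDr.
  rewrite FE innerDl//; last exact: sG.
  rewrite innerZl//; last exact: sG.
  rewrite innerDl//; last exact: sG.
  rewrite !E// /r (innerC (quot_error G G' t s) (F t)).
  rewrite (innerC (quot_error G G' t s) (F' t)); ring.
by field.
Unshelve. all: by end_near.
Qed.

Lemma has_derivativeD T V V' W W' : has_derivative T V V' ->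
  has_derivative T W W' ->
  has_derivative T (fun t => V t + W t) (fun t => V' t + W' t).
Proof.
move=> dV dW t dt.
have -> : (fun s => (s - t)^-1 * (V s + W s - (V t + W t))) =
    (fun s => (s - t)^-1 * (V s - V t) + (s - t)^-1 * (W s - W t)).
  by apply/funext => s; rewrite -mulrDr; congr (_ * _); ring.
by apply: cvgD; [exact: dV|exact: dW].
Qed.

Lemma has_derivativeZ T c V V' : has_derivative T V V' ->
  has_derivative T (fun t => c * V t) (fun t => c * V' t).
Proof.
move=> dV t dt.
have -> : (fun s => (s - t)^-1 * (c * V s - c * V t)) =
    (fun s => c * ((s - t)^-1 * (V s - V t))).
  by apply/funext => s; rewrite -mulrBr mulrCA.
by apply: cvgM; [exact: cvg_cst|exact: dV].
Qed.

(** Squaring [h 0 = h x - \int_0^x h'] and integrating over [x]. *)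
Lemma trace0_le h h' : primitive01 h h' -> sqint h' ->
  h 0 ^+ 2 <= 2 * inner h h + 2 * inner h' h'.
Proof.
move=> ph sh'; have sh := primitive01_sqint ph; have [h'1 hh'] := ph.
set M := int01 (fun x => `|h' x|).
have ab1 : L1 (fun x => `|h' x|) := L1_abs h'1.
have MN : M ^+ 2 <= inner h' h'.
  have sa : sqint (fun x => `|h' x|).
    apply: (sqint_le (g := h')) => //; first exact: L1_measurable.
    by move=> x _; rewrite normr_id.
  have := inner_CauchySchwarz (@sqint1 R) sa.
  have -> : inner (fun=> 1) (fun x => `|h' x|) = M.
    by congr int01; apply/funext => x; rewrite mul1r.
  have -> : inner (fun x => `|h' x|) (fun x => `|h' x|) = inner h' h'.
    by congr int01; apply/funext => x; rewrite -!expr2 real_normK ?num_real.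
  have -> : inner (fun=> 1) (fun=> 1) = 1 :> R.
    by rewrite /inner int01_cst mulr1.
  by rewrite mul1r.
have M1 x : 0 <= x <= 1 -> `|h x - h 0| <= M.
  move=> /andP[x0 x1]; rewrite hh'//.
  apply: (le_trans (le_normr_Rintegral _ (L1_sub (lexx 0) x1 h'1))) => //.
  rewrite Rintegral_int01//; apply: le_int01 => //; first exact: L1_mul_indic.
  by move=> y _; rewrite indicE; case: (_ \in _); rewrite ?mulr1 ?mulr0.
have M0 : 0 <= M by apply: int01_ge0.
have [_ h2] := sh.
have : int01 (fun=> h 0 ^+ 2) <= int01 (fun x => 2 * h x ^+ 2 + 2 * M ^+ 2).
  apply: le_int01.
  - exact: L1_cst.
  - by apply: L1D; [exact: L1Z|exact: L1_cst].
  move=> x /M1; rewrite ler_norml => /andP[H1 H2].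
  have : (h x - h 0) ^+ 2 <= M ^+ 2 by nra.
  have := sqr_ge0 (2 * h x - h 0); nra.
rewrite (int01D (L1Z 2 h2) (L1_cst _)) (int01Z 2 h2).
rewrite !int01_cst.
have -> : int01 (fun x => h x ^+ 2) = inner h h.
  by congr int01; apply/funext => x; rewrite expr2.
lra.
Qed.

Lemma time_dom_right T t : time_dom T t -> exists2 d, 0 < d &
  forall s, 0 <= s -> s < t + d -> time_dom T s.
Proof.
move=> [t0]; case: T => [r| |] //=.
  rewrite lte_fin => tr; exists (r - t); first lra.
  by move=> s s0 st; split => //; rewrite lte_fin; lra.
by move=> _; exists 1 => // s s0 _; split => //; exact: ltry.
Qed.

Lemma time_dom_le T t s : time_dom T t -> 0 <= s -> s <= t -> time_dom T s.
Proof.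
by move=> [_ tT] s0 st; split => //; apply: le_lt_trans tT; rewrite lee_fin.
Qed.

Lemma within_time_dom_proper T t : time_dom T t ->
  ProperFilter (within (time_dom T) t^').
Proof.
move=> dt; apply: Build_ProperFilter_ex => P H.
have /nbhs_ballP[d /= d0 dP] : nbhs t (fun s => s != t -> time_dom T s -> P s).
  exact: H.
have [d' d'0 dT] := time_dom_right dt; have [t0 _] := dt.
pose m := Num.min d d' / 2.
have m0 : 0 < m by rewrite divr_gt0// lt_min d0.
have m1 : Num.min d d' <= d by rewrite ge_min lexx.
have m2 : Num.min d d' <= d' by rewrite ge_min lexx orbT.
have md : m < d by rewrite /m; lra.
have md' : m < d' by rewrite /m; lra.
exists (t + m); apply: dP.
- by rewrite /ball/= opprD addNKr normrN gtr0_norm.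
- by rewrite gt_eqF//; lra.
- by apply: dT; lra.
Qed.

(** The difference quotients converge in W^1_2, where the trace at 0 is
  continuous by [trace0_le]; their traces vanish. *)
Lemma trace0_derivative T F F' Fx F'x :
  L2diff T F F' -> L2diff T Fx F'x ->
  (forall t, time_dom T t -> primitive01 (F t) (Fx t)) ->
  (forall t, time_dom T t -> primitive01 (F' t) (F'x t)) ->
  (forall t, time_dom T t -> F t 0 = 0) ->
  forall t, time_dom T t -> F' t 0 = 0.
Proof.
move=> DF DFx pF pF' F0 t dt; have PF := within_time_dom_proper dt.
apply/eqP; rewrite -sqrf_eq0 eq_le sqr_ge0 andbT.
apply/ler_addgt0Pr => e e0; rewrite add0r.
have e4 : 0 < e / 4 by lra.
have [s [ds Hs Hxs]] : exists s, [/\ time_dom T s,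
    inner (quot_error F F' t s) (quot_error F F' t s) < e / 4 &
    inner (quot_error Fx F'x t s) (quot_error Fx F'x t s) < e / 4].
  near (within (time_dom T) t^') => s; exists s; split; near: s.
  - exact: (near_within_self (time_dom T) t).
  - exact: (L2diff_cvg0 DF dt e4).
  - exact: (L2diff_cvg0 DFx dt e4).
have pq : primitive01 (quot_error F F' t s) (quot_error Fx F'x t s).
  apply: primitive01B; last exact: pF'.
  by apply: primitive01Z; apply: primitive01B; exact: pF.
have := trace0_le pq (sqint_quot_error DFx dt ds).
have -> : quot_error F F' t s 0 = - F' t 0 by rewrite /quot_error !F0//; ring.
rewrite sqrrN; lra.
Unshelve. all: by end_near.
Qed.

Lemma has_derivative_continuous T V V' t : has_derivative T V V' ->
  time_dom T t -> V s @[s --> within (time_dom T) (nbhs t)] --> V t.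
Proof.
move=> dV dt; have {}dV := dV t dt.
have c0 : (s - t) * ((s - t)^-1 * (V s - V t)) @[s --> within (time_dom T) t^']
    --> (0 : R).
  have -> : 0 = (t - t) * V' t :> R by ring.
  apply: cvgM => //; apply: cvgB; last exact: cvg_cst.
  by apply: cvg_within_filter; apply: cvg_within_filter; exact: cvg_id.
apply/cvgrPdist_lt => e e0.
have /cvgrPdist_lt/(_ e e0) H := c0.
have {}H : \forall s \near t, s != t -> time_dom T s ->
   `|0 - (s - t) * ((s - t)^-1 * (V s - V t))| < e by exact: H.
rewrite near_withinE; near=> s => ds.
have [->|st] := eqVneq s t; first by rewrite subrr normr0.
have : s != t -> time_dom T s ->
   `|0 - (s - t) * ((s - t)^-1 * (V s - V t))| < e by near: s.
move=> /(_ st ds); rewrite sub0r normrN mulVKf ?subr_eq0// distrC.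
Unshelve. all: by end_near.
Qed.

Lemma has_derivative_is_derive T V V' t : has_derivative T V V' ->
  time_dom T t -> 0 < t -> is_derive t 1 V (V' t).
Proof.
move=> dV dt t0.
have C : h^-1 *: (V (h *: 1 + t) - V t) @[h --> 0^'] --> V' t.
  apply/cvgrPdist_lt => e e0.
  have /cvgrPdist_lt/(_ e e0) := dV t dt.
  move=> H; have /nbhs_ballP[r /= r0 Hr] : nbhs t (fun s => s != t ->
    time_dom T s -> `|V' t - (s - t)^-1 * (V s - V t)| < e) by exact: H.
  have [d d0 dT] := time_dom_right dt.
  exists (Num.min r (Num.min t d)) => /=; first by rewrite !lt_min r0 t0.
  move=> h; rewrite /ball/= sub0r normrN !lt_min => /and3P[hr ht hd] h0.
  have -> : (h^-1 *: (V (h *: 1 + t) - V t)) =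
    (h + t - t)^-1 * (V (h + t) - V t) by rewrite addrK /GRing.scale/= mulr1.
  apply: Hr.
  - by rewrite /ball/= opprD addrCA subrr addr0 normrN.
  - by rewrite -subr_eq0 addrK.
  - by move: ht hd; rewrite !ltr_norml => /andP[? ?] /andP[? ?]; apply: dT; lra.
split; first by apply/cvg_ex; exists (V' t).
exact: cvg_lim.
Qed.

(** [V t * expR (c * t)] is nonincreasing. *)
Lemma gronwall T V V' c : has_derivative T V V' ->
  (forall t, time_dom T t -> V' t <= - c * V t) ->
  forall t, time_dom T t -> V t <= V 0 * expR (- (c * t)).
Proof.
move=> dV Vc t dt; have [t0 _] := dt.
pose W s := V s * expR (c * s).
have dE s : is_derive s 1 (fun y => expR (c * y)) (c * expR (c * s)).
  have H : is_derive s 1 (fun y => c * y) c.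
    by apply: is_derive_eq; rewrite /GRing.scale/= mulr1.
  by apply: is_derive_eq; rewrite /GRing.scale/= mulrC.
have dW s : s \in `]0, t[%R ->
    is_derive s 1 W (V' s * expR (c * s) + V s * (c * expR (c * s))).
  rewrite in_itv/= => /andP[s0 st].
  have ds : time_dom T s by apply: (time_dom_le dt); exact: ltW.
  have H := has_derivative_is_derive dV ds s0.
  by apply: is_derive_eq; rewrite /GRing.scale/=; ring.
have : W t <= W 0.
  apply: (@ler0_derive1_nincr R W 0 t) => //.
  - by move=> s /dW[].
  - move=> s st; rewrite derive1E; have /@derive_val -> := dW s st.
    move: st; rewrite in_itv/= => /andP[s0 st].
    have ds : time_dom T s by apply: (time_dom_le dt); exact: ltW.
    have := Vc s ds; have := expR_gt0 (c * s); nra.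
  apply/subspace_continuousP => s /=; rewrite in_itv/= => /andP[s0 st].
  have ds : time_dom T s by apply: (time_dom_le dt).
  have cE : {for s, continuous (fun y => expR (c * y))}.
    by apply/differentiable_continuous/derivable1_diffP; case: (dE s).
  apply: cvgM; last by apply: cvg_within_filter; exact: cE.
  move=> P nP.
  have C : \forall y \near s, time_dom T y -> P (V y).
    exact: (has_derivative_continuous dV ds nP).
  have : \forall y \near s, `[0, t]%classic y -> P (V y); last exact.
  near=> y; rewrite /= in_itv/= => /andP[y0 yt].
  have : time_dom T y -> P (V y) by near: y.
  by apply; apply: (time_dom_le dt).
rewrite /W mulr0 expR0 mulr1 => H.
by rewrite expRN ler_pdivlMr ?expR_gt0.
Unshelve. all: by end_near.
Qed.

End curves.

(** * The Lyapunov function *)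

Section lyapunov.
Context {R : realType}.
Implicit Types (f g h : R -> R) (F G : R -> R -> R) (T : \bar R)
  (k beta eps alpha s t x y : R).

(** Here [F] and [G] stand for [e_t] and [e_x]. *)
Definition lyapunov (k eps : R) (F G : R -> R -> R) (t : R) : R :=
  2^-1 * (inner (F t) (F t) + k * inner (G t) (G t)) +
  eps * inner (fun x => x * G t x) (F t).

Lemma lyapunov_derivative k eps T F F' G G' : L2diff T F F' -> L2diff T G G' ->
  has_derivative T (lyapunov k eps F G)
    (fun t => inner (F' t) (F t) + k * inner (G' t) (G t) +
      eps * (inner (fun x => x * G' t x) (F t) +
             inner (fun x => x * G t x) (F' t))).
Proof.
move=> DF DG.
have D1 := has_derivativeD (inner_derivative DF DF)
  (has_derivativeZ (c := k) (inner_derivative DG DG)).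
have D2 := has_derivativeZ (c := eps) (inner_derivative (L2diff_mulx DG) DF).
have D := has_derivativeD (has_derivativeZ (c := 2^-1) D1) D2.
move=> t dt; have := D t dt.
set l1 := (X in _ --> X -> _); set l2 := (X in _ -> _ --> X).
suff -> : l1 = l2 by [].
rewrite /l1 /l2 (innerC (F t) (F' t)) (innerC (G t) (G' t)).
by field.
Qed.

Lemma error_energyE k (z : trajectory R) t :
  sqint (dt z t) -> sqint (dx z t) ->
  error_energy k z t =
    2^-1 * (inner (dt z t) (dt z t) + k * inner (dx z t) (dx z t)).
Proof.
move=> [_ s1] [_ s2]; rewrite /error_energy int01D ?int01Z//; exact: L1Z.
Qed.

Lemma sin_lipschitz x y : `|sin x - sin y| <= `|x - y|.
Proof.
wlog xy : x y / y <= x.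
  move=> H; have [/H//|/ltW /H] := leP y x.
  by rewrite distrC (distrC x).
have cs : {within `[y, x], continuous (@sin R)}.
  exact: continuous_subspaceT (@continuous_sin R).
have [c _ ->] := MVT_segment xy (fun z _ => is_derive_sin z) cs.
by rewrite normrM ler_piMl// ler_norml cos_geN1 cos_le1.
Qed.

(** The derivative of the Lyapunov function at a given time, for [a = e_t],
  [b = e_x] and [g = sin z - sin zh].  Integrations by parts leave the boundary
  term [(eps k alpha^2 / 2 - k alpha + eps / 2) a(1)^2 <= 0], and each product
  with [g] is split evenly by Young's inequality. *)
Lemma lyapunov_dissipation (k beta eps alpha : R) (e b bx a ax att g : R -> R) :
  0 < k -> 0 < beta -> 0 < eps ->
  eps * k / 2 * alpha ^+ 2 - k * alpha + eps / 2 <= 0 ->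
  primitive01 e b -> primitive01 b bx -> primitive01 a ax ->
  sqint bx -> sqint ax -> sqint att -> sqint g ->
  (forall h, sqint h -> inner att h = k * inner bx h - beta * inner g h) ->
  (forall x, 0 <= x <= 1 -> `|g x| <= `|e x|) ->
  e 0 = 0 -> a 0 = 0 -> b 1 = - alpha * a 1 ->
  inner att a + k * inner ax b +
    eps * (inner (fun x => x * ax x) a + inner (fun x => x * b x) att) <=
  - ((eps - beta) / 2 * inner a a +
     (eps * k / 2 - 2 * beta / pi ^+ 2 - eps * beta / 2 * (1 + 4 / pi ^+ 2))
       * inner b b).
Proof.
move=> k0 beta0 eps0 quad pe pb pa sbx sax satt sg attE ge e0 a0 b1.
have se := primitive01_sqint pe; have sb := primitive01_sqint pb.
have sa := primitive01_sqint pa; have sxb := sqint_mulx sb.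
have I1 := inner_ibp pb pa sbx sax.
rewrite a0 mulr0 subr0 b1 in I1.
have I2 := inner_ibp_mulx pa sax.
have I3 := inner_ibp_mulx pb sbx.
rewrite b1 in I3.
rewrite (innerC (fun x => x * b x) att) !attE//.
have -> : inner bx (fun x => x * b x) = inner (fun x => x * bx x) b.
  by congr int01; apply/funext => x /=; ring.
rewrite (innerC b ax) in I1.
have P : inner g g <= 4 / pi ^+ 2 * inner b b.
  apply: (le_trans (le_inner sg se ge)).
  exact: poincare.
have := inner_young sg sa; rewrite ler_norml => /andP[Y1 _].
have := inner_young sg sxb; rewrite ler_norml => /andP[Y2 _].
have Y3 := inner_mulx_le sb.
set q := 4 / pi ^+ 2 in P *.
have -> : 2 * beta / pi ^+ 2 = beta / 2 * q.
  by rewrite /q; move: (pi ^+ 2)^-1 => r; lra.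
set A := inner a a in I2 Y1 *. set B := inner b b in I3 Y3 P *.
set ga := inner g a in Y1 *. set gb := inner g (fun x => x * b x) in Y2 *.
set gg := inner g g in Y1 Y2 P.
have eb0 : 0 < eps * beta by rewrite mulr_gt0.
have Z1 := ler_wpM2l (ltW beta0) Y1.
have Z2 := ler_wpM2l (ltW eb0) Y2.
have Z3 := ler_wpM2l (ltW eb0) Y3.
have Z4 := ler_wpM2l (ltW beta0) P.
have Z5 := ler_wpM2l (ltW eb0) P.
have Z6 : (eps * k / 2 * alpha ^+ 2 - k * alpha + eps / 2) * a 1 ^+ 2 <= 0.
  by rewrite mulr_le0_ge0// sqr_ge0.
have I1' : k * inner bx a + k * inner ax b = - (k * alpha * a 1 ^+ 2).
  by rewrite -mulrDr I1; ring.
have I2' : eps * inner (fun x => x * ax x) a = eps * (a 1 ^+ 2 - A) / 2.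
  by rewrite -I2; field.
have I3' : eps * k * inner (fun x => x * bx x) b =
    eps * k * (alpha ^+ 2 * a 1 ^+ 2 - B) / 2.
  have -> : alpha ^+ 2 * a 1 ^+ 2 = (- alpha * a 1) ^+ 2 by ring.
  by rewrite -I3; field.
lra.
Qed.

End lyapunov.

(** * The error between two trajectories *)

Section error.
Context {R : realType}.
Implicit Types (f g h : R -> R) (T : \bar R) (z zh : trajectory R)
  (k beta eps s t x : R).

Lemma regular_primitive01 T z t : regular T z -> time_dom T t ->
  [/\ primitive01 (z t) (dx z t), primitive01 (dx z t) (dxx z t) &
      primitive01 (dt z t) (dtx z t)].
Proof.
by move=> [W _ _ _] dom_t; have [? ? ? _] := W t dom_t; split;
  exact: W12_primitive.
Qed.

Lemma regular_sqint T z t : regular T z -> time_dom T t ->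
  [/\ sqint (dxx z t), sqint (dtx z t) & sqint (dtt z t)].
Proof.
move=> [W _ _ _] dom_t; have [_ [_ ? _ _] [_ ? _ _] ?] := W t dom_t.
by split; exact: in_L2_sqint.
Qed.

Lemma regular_L2diff T z : regular T z ->
  [/\ L2diff T z (dt z), L2diff T (dx z) (dtx z) & L2diff T (dt z) (dtt z)].
Proof.
move=> rz; have [_ _ [Dz Dzx _ _] [Dzt _]] := rz.
have P s (ds : time_dom T s) := regular_primitive01 rz ds.
have S s (ds : time_dom T s) := regular_sqint rz ds.
have sz s : time_dom T s -> sqint (z s).
  by move=> /P[/primitive01_sqint].
have szx s : time_dom T s -> sqint (dx z s).
  by move=> /P[_ /primitive01_sqint].
have szt s : time_dom T s -> sqint (dt z s).
  by move=> /P[_ _ /primitive01_sqint].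
by split; apply: L2_derivative_L2diff => // s /S[].
Qed.

Lemma sqint_sin f : sqint f -> sqint (fun x => sin (f x)).
Proof.
move=> [mf _]; apply: (sqint_le _ _ (@sqint1 R)).
  apply: measurableT_comp => //; apply: continuous_measurable_fun.
  exact: continuous_sin.
by move=> x _; rewrite normr1 ler_norml sin_geN1 sin_le1.
Qed.

(** The equation holds almost everywhere only, so it is used through inner
  products. *)
Lemma inner_error_equation k beta T z zh t h :
  regular T z -> regular T zh ->
  sine_gordon k beta T z -> sine_gordon k beta T zh ->
  time_dom T t -> sqint h ->
  inner (dtt (traj_sub z zh) t) h = k * inner (dxx (traj_sub z zh) t) h -
    beta * inner (fun x => sin (z t x) - sin (zh t x)) h.
Proof.
move=> rz rzh eqz eqzh dom_t sh.
have [sxx _ stt] := regular_sqint rz dom_t.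
have [sxxh _ stth] := regular_sqint rzh dom_t.
have [/primitive01_sqint sz _ _] := regular_primitive01 rz dom_t.
have [/primitive01_sqint szh _ _] := regular_primitive01 rzh dom_t.
have sexx := sqintB sxx sxxh; have sett := sqintB stt stth.
have sg := sqintB (sqint_sin sz) (sqint_sin szh).
rewrite -innerZl// -innerZl// -innerBl//; [|exact: sqintZ..].
apply: ae_eq_int01; [exact: sqint_L1M|apply: sqint_L1M => //|].
  by apply: sqintB; exact: sqintZ.
have [[N [mN N0 sN]] [N' [mN' N'0 sN']]] := (eqz t dom_t, eqzh t dom_t).
exists (N `|` N'); split; [exact: measurableU|exact: null_set_setU|].
move=> x /= H; apply: contrapT => /not_orP[Nx N'x]; apply: H => x01.
have Ez : dtt z t x - k * dxx z t x + beta * sin (z t x) = 0.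
  by apply: contrapT => H; apply: Nx; apply: sN => /(_ x01).
have Ezh : dtt zh t x - k * dxx zh t x + beta * sin (zh t x) = 0.
  by apply: contrapT => H; apply: N'x; apply: sN' => /(_ x01).
by congr (_ * _) => /=; lra.
Qed.

End error.

Theorem theorem1 (R : realType) (k beta Hstar : R) (psi : R -> R)
  (k_gt0 : 0 < k) (beta_gt0 : 0 < beta) (Hstar_ge0 : 0 <= Hstar)
  (psi_cont : continuous psi) (psi0 : psi 0 = 0)
  (psi_sign : forall s, s != 0 -> 0 < psi s * s)
  (W0 : R -> R -> set ((R -> R) * (R -> R)))
  (beta_k : (1 + 4 / pi ^+ 2) * beta < k)
  (eta_small : eta_gain beta k < Num.min 1 k)
  (WP : well_posed (System k beta Hstar psi) W0)
  (eps : R) (eps_range : eta_gain beta k < eps < Num.min 1 k)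
  (alpha : R) (alpha_gt0 : 0 < alpha)
  (alpha_quad : eps * k / 2 * alpha ^+ 2 - k * alpha + eps / 2 <= 0) :
  exists delta M : R, [/\ 0 < delta, 0 < M &
    forall gamma : R, 0 < gamma ->
    forall d dh, W0 alpha gamma d -> W0 alpha gamma dh ->
    forall (T : \bar R) (z zh : trajectory R),
      WP_solution (System k beta Hstar psi) alpha gamma d dh T z zh ->
      forall t, time_dom T t ->
        error_energy k (traj_sub z zh) t
          <= M * error_energy k (traj_sub z zh) 0 * expR (- (delta * t))].
Proof.
have [beta_eps D_eps eps_m] : [/\ beta < eps,
    4 * beta / (pi ^+ 2 * k - (pi ^+ 2 + 4) * beta) < eps & eps < Num.min 1 k].
  by move: eps_range; rewrite /eta_gain gt_max => /andP[/andP[-> ->] ->].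
have eps_gt0 : 0 < eps by exact: lt_trans beta_eps.
have pi2 : 0 < pi ^+ 2 :> R by rewrite exprn_gt0// pi_gt0.
set q : R := 4 / pi ^+ 2 in beta_k *.
(* the coefficients of [\int e_t^2] and [\int e_x^2] in the dissipation *)
pose c1 := (eps - beta) / 2.
pose c2 := eps * k / 2 - 2 * beta / pi ^+ 2
  - eps * beta / 2 * (1 + 4 / pi ^+ 2).
have c1_gt0 : 0 < c1 by rewrite divr_gt0// subr_gt0.
have c2_gt0 : 0 < c2.
  (* [c2] is positive when [eps] exceeds the second argument of the maximum
     that defines [eta_gain] *)
  have D0 : 0 < pi ^+ 2 * k - (pi ^+ 2 + 4) * beta.
    have -> : pi ^+ 2 * k - (pi ^+ 2 + 4) * beta =
        pi ^+ 2 * (k - (1 + q) * beta).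
      rewrite /q; move: pi2; move: (pi ^+ 2) => p p0; field; exact: lt0r_neq0.
    by rewrite mulr_gt0// subr_gt0.
  move: D_eps; rewrite ltr_pdivrMr// => D_eps.
  have -> : c2 = (eps * (pi ^+ 2 * k - (pi ^+ 2 + 4) * beta) - 4 * beta)
      / (2 * pi ^+ 2).
    rewrite /c2; move: pi2; move: (pi ^+ 2) => p p0; field; exact: lt0r_neq0.
  by rewrite divr_gt0 ?subr_gt0// mulr_gt0.
pose m : R := Num.min 1 k.
have m_gt0 : 0 < m by rewrite lt_min ltr01.
have m1 : m <= 1 by rewrite ge_min lexx.
have mk : m <= k by rewrite ge_min lexx orbT.
(* [|eps \int x e_x e_t| <= c E] *)
pose c := eps / m.
have c_gt0 : 0 < c by rewrite divr_gt0.
have c_lt1 : c < 1 by rewrite ltr_pdivrMr// mul1r.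
pose delta := Num.min c1 (c2 / k).
have delta_gt0 : 0 < delta by rewrite lt_min c1_gt0 divr_gt0.
exists delta, ((1 + c) / (1 - c)); split => //.
  by rewrite divr_gt0//; lra.
move=> gamma gamma_gt0 d dh Wd Wdh T z zh.
move=> [[[T0 [rz rzh] [sgz sgzh] _ bc] _] _ _ _] t dom_t.
have e0 s : time_dom T s -> z s 0 - zh s 0 = 0.
  by move=> ds; have [-> _ -> _] := bc s ds; rewrite subrr.
have b1 s : time_dom T s ->
    dx z s 1 - dx zh s 1 = - alpha * (dt z s 1 - dt zh s 1).
  (* the control cancels here *)
  by move=> ds; have [_ -> _ ->] := bc s ds; ring.
pose e := traj_sub z zh.
pose g t x := sin (z t x) - sin (zh t x).
have [Dz Dzx Dzt] := regular_L2diff rz.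
have [Dzh Dzhx Dzht] := regular_L2diff rzh.
have De : L2diff T e (dt e) := L2diffB Dz Dzh.
have Db : L2diff T (dx e) (dtx e) := L2diffB Dzx Dzhx.
have Da : L2diff T (dt e) (dtt e) := L2diffB Dzt Dzht.
have prim s : time_dom T s -> [/\ primitive01 (e s) (dx e s),
    primitive01 (dx e s) (dxx e s) & primitive01 (dt e s) (dtx e s)].
  move=> ds; have [? ? ?] := regular_primitive01 rz ds.
  have [? ? ?] := regular_primitive01 rzh ds.
  by split; exact: primitive01B.
have pe s : time_dom T s -> primitive01 (e s) (dx e s) by move=> /prim[].
have pb s : time_dom T s -> primitive01 (dx e s) (dxx e s) by move=> /prim[].
have pa s : time_dom T s -> primitive01 (dt e s) (dtx e s) by move=> /prim[].
have a0 : forall s, time_dom T s -> dt e s 0 = 0.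
  exact: trace0_derivative De Db pe pa e0.
have sg s : time_dom T s -> sqint (g s).
  move=> ds; have [/primitive01_sqint sz _ _] := regular_primitive01 rz ds.
  have [/primitive01_sqint szh _ _] := regular_primitive01 rzh ds.
  by apply: sqintB; exact: sqint_sin.
pose V := lyapunov k eps (dt e) (dx e).
have dV := lyapunov_derivative (k := k) (eps := eps) Da Db.
have dissip s : time_dom T s ->
  inner (dtt e s) (dt e s) + k * inner (dtx e s) (dx e s) +
      eps * (inner (fun x => x * dtx e s x) (dt e s) +
             inner (fun x => x * dx e s x) (dtt e s)) <=
  - (c1 * inner (dt e s) (dt e s) + c2 * inner (dx e s) (dx e s)).
  move=> ds.
  apply: (@lyapunov_dissipation R k beta eps alpha (e s) (dx e s) (dxx e s)
    (dt e s) (dtx e s) (dtt e s) (g s)) => //;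
    [exact: pe|exact: pb|exact: pa|..].
  - have [? _ _] := regular_sqint rz ds; have [? _ _] := regular_sqint rzh ds.
    exact: sqintB.
  - by have [_ H _] := Db; exact: H.
  - by have [_ H _] := Da; exact: H.
  - exact: sg.
  - by move=> h sh; exact: (inner_error_equation rz rzh sgz sgzh ds sh).
  - by move=> x _; exact: sin_lipschitz.
  - exact: e0.
  - exact: a0.
  - exact: b1.
pose A s := inner (dt e s) (dt e s).
pose B s := inner (dx e s) (dx e s).
pose E s := 2^-1 * (A s + k * B s).
have A0 s : 0 <= A s by exact: inner_ge0.
have B0 s : 0 <= B s by exact: inner_ge0.
have EE s : time_dom T s -> error_energy k e s = E s.
  move=> ds; apply: error_energyE.
    by have [_ H _] := De; exact: H.
  by have [H _ _] := Db; exact: H.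
have VE s : time_dom T s -> (1 - c) * E s <= V s <= (1 + c) * E s.
  move=> ds.
  have sa : sqint (dt e s) by have [_ H _] := De; exact: H.
  have sb : sqint (dx e s) by have [H _ _] := Db; exact: H.
  have := inner_young (sqint_mulx sb) sa.
  have := inner_mulx_le sb; rewrite -/(A s) -/(B s).
  rewrite ler_norml /V /lyapunov -/(A s) -/(B s) -/(E s).
  set J := inner _ (dt e s); set X := inner _ _ => XB /andP[J1 J2].
  have cE : eps / 2 * (A s + B s) <= c * E s.
    have -> : c * E s = eps / 2 * ((A s + k * B s) / m).
      by rewrite /c /E; field; exact: lt0r_neq0.
    apply: ler_wpM2l; first by rewrite divr_ge0// ltW.
    rewrite ler_pdivlMr//.
    have := A0 s; have := B0 s; nra.
  have J3 := ler_wpM2l (ltW eps_gt0) J1; have J4 := ler_wpM2l (ltW eps_gt0) J2.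
  have X3 := ler_wpM2l (ltW eps_gt0) XB.
  by apply/andP; split; lra.
have Vdecay s : time_dom T s ->
  inner (dtt e s) (dt e s) + k * inner (dtx e s) (dx e s) +
      eps * (inner (fun x => x * dtx e s x) (dt e s) +
             inner (fun x => x * dx e s x) (dtt e s)) <= - delta * V s.
  move=> ds; apply: (le_trans (dissip s ds)); rewrite -/(A s) -/(B s).
  have /andP[_ V1] := VE s ds.
  have V2 : V s <= A s + k * B s.
    have E0 : 0 <= E s by rewrite /E mulr_ge0// addr_ge0// mulr_ge0// ltW.
    have : E s * 2 = A s + k * B s by rewrite /E mulrAC mulVf ?mul1r.
    nra.
  have d1 : delta <= c1 by rewrite ge_min lexx.
  have d2 : delta * k <= c2 by rewrite -ler_pdivlMr// ge_min lexx orbT.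
  have V3 := ler_wpM2l (ltW delta_gt0) V2.
  have := ler_wpM2r (A0 s) d1; have := ler_wpM2r (B0 s) d2; lra.
have := gronwall dV Vdecay dom_t; rewrite -/V => VV.
have dom0 : time_dom T 0 by apply: (time_dom_le dom_t) => //; case: dom_t.
rewrite !EE//.
have /andP[V1 _] := VE t dom_t; have /andP[_ V2] := VE 0 dom0.
rewrite -[leRHS]mulrA mulrAC ler_pdivlMr; last lra.
rewrite mulrC (le_trans V1)// (le_trans VV)// mulrA ler_wpM2r//.
Qed.
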